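(* For all integers $n>3$ and all $a\in(0,2)$, the inequality $\frac{\partial}{\partial a}E(n,a)>0$ holds. Moreover, for every integer $n>3$, the function $a\mapsto E(n,a)$ on $[0,2)$ attains a minimum at $a=0$, and this minimum is unique (that is, $a=0$ is the only minimizer).
   Context: Here $\|\cdot\|$ is the Euclidean norm on $\mathbb{R}^n$, $e_1$ is the first canonical basis vector and $x_1$ is the first coordinate of $x\in\mathbb{R}^n$. For $a\in\mathbb{R}$, $\mathbb{S}_a=\{x\in\mathbb{R}^n:\|x-ae_1\|=1\}$ and $\sigma_a$ is the normalized (total mass one) surface measure on $\mathbb{S}_a$: $\sigma_0$ is the rotation-invariant Borel probability measure on the unit sphere $\mathbb{S}_0$, and $\sigma_a(A+ae_1)=\sigma_0(A)$ for Borel sets $A$. Let $\rho=\frac12(\sigma_{-1}+\sigma_1)$, a Borel probability measure with support $S=\mathbb{S}_{-1}\cup\mathbb{S}_1$. Mean-squared error: for a Borel measurable subset $S_1\subset S$ with complement $S_2=S\setminus S_1$, $$\mathcal{E}(S_1)=\min_{c_1\in\mathbb{R}^n}\int_{S_1}\|x-c_1\|^2\,d\rho(x)+\min_{c_2\in\mathbb{R}^n}\int_{S_2}\|x-c_2\|^2\,d\rho(x).$$ For the measure $\rho$ in dimension $n$, set $E(n,a)=\mathcal{E}(\{x\in S: x_1\le -a\})$. *)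

(* Defs.v *)
From HB Require Import structures.
From mathcomp Require Import all_boot all_order all_algebra.
From mathcomp Require Import all_classical all_reals all_analysis.

Set Implicit Arguments.
Unset Strict Implicit.
Unset Printing Implicit Defensive.

Import Order.TTheory GRing.Theory Num.Theory.
Import numFieldNormedType.Exports.

Local Open Scope classical_set_scope.
Local Open Scope ring_scope.

(* R^(n+1) with its Borel sigma-algebra. *)
Notation borelRV R n := (g_sigma_algebraType (@open 'rV[R]_n.+1)).

(* The library norm `|x| on row vectors is the sup norm, hence this definition. *)
Definition enorm (R : realType) (n : nat) (x : 'rV[R]_n.+1) : R :=
  Num.sqrt (\sum_i x ord0 i ^+ 2).

Definition e1 (R : realType) (n : nat) : 'rV[R]_n.+1 := delta_mx ord0 ord0.

Definition sphere (R : realType) (n : nat) (a : R) : set (borelRV R n) :=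
  [set x : 'rV[R]_n.+1 | enorm (x - a *: e1 R n) = 1].

Definition rotation (R : realType) (n : nat) (Q : 'M[R]_n.+1) : Prop :=
  Q *m Q^T = 1%:M /\ \det Q = 1.

(* These two properties determine sigma0 uniquely when the dimension n.+1 is
   at least 2, SO(n.+1) being transitive on the unit sphere. *)
Definition uniform_on_sphere (R : realType) (n : nat)
    (sigma0 : probability (borelRV R n) R) : Prop :=
  sigma0 (sphere 0) = 1%E /\
  forall Q : 'M[R]_n.+1, rotation Q ->
    forall A : set (borelRV R n), measurable A ->
      sigma0 [set x : 'rV[R]_n.+1 | A (x *m Q)] = sigma0 A.

Definition translate (R : realType) (n : nat) (a : R) :
    borelRV R n -> borelRV R n :=
  fun x : 'rV[R]_n.+1 => x + a *: e1 R n.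

Lemma measurable_translate (R : realType) (n : nat) (a : R) :
  measurable_fun [set: borelRV R n] (@translate R n a).
Proof.
apply: (@measurability _ _ _ (borelRV R n) _ _ (@open 'rV[R]_n.+1)) => //.
move=> _ [U oU <-]; rewrite setTI.
apply: sub_sigma_algebra.
apply: (@open_comp 'rV[R]_n.+1 'rV[R]_n.+1 (fun x => x + a *: e1 R n)) oU.
by move=> x _; exact: (cvgD cvg_id (cvg_cst _)).
Qed.

Section sigma.
Local Open Scope ereal_scope.
Variables (R : realType) (n : nat) (sigma0 : probability (borelRV R n) R).
Variable a : R.

Definition sigma : set (borelRV R n) -> \bar R :=
  pushforward sigma0 (@translate R n a).

Let mtr := @measurable_translate R n a.

Let sigma_set0 : sigma set0 = 0.
Proof. by rewrite /sigma /pushforward preimage_set0 measure0. Qed.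

Let sigma_ge0 A : 0 <= sigma A.
Proof. exact: measure_ge0. Qed.

Let sigma_additive : semi_sigma_additive sigma.
Proof.
move=> F mF tF mUF; rewrite /sigma /pushforward preimage_bigcup.
apply: measure_semi_sigma_additive.
- by move=> k; rewrite -[X in measurable X]setTI; exact: mtr.
- apply/trivIsetP => /= i j _ _ ij; rewrite -preimage_setI.
  by move/trivIsetP : tF => /(_ _ _ _ _ ij) ->//; rewrite preimage_set0.
- by rewrite -preimage_bigcup -[X in measurable X]setTI; exact: mtr.
Qed.

HB.instance Definition _ := isMeasure.Build _ _ _ sigma
  sigma_set0 sigma_ge0 sigma_additive.

End sigma.

Definition rho (R : realType) (n : nat) (sigma0 : probability (borelRV R n) R) :
    {measure set (borelRV R n) -> \bar R} :=
  mscale (2^-1)%:nng (measure_add (sigma sigma0 (-1)) (sigma sigma0 1)).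

Definition supp (R : realType) (n : nat) : set (borelRV R n) :=
  sphere (-1) `|` sphere 1.

(* The infimum over the centre c is a minimum, attained at the barycentre of
   mu restricted to A. *)
Definition cluster_cost (R : realType) (n : nat)
    (mu : {measure set (borelRV R n) -> \bar R}) (A : set (borelRV R n)) :
    \bar R :=
  ereal_inf [set (\int[mu]_(x in A) (enorm ((x : 'rV[R]_n.+1) - c) ^+ 2)%:E)%E
            | c in [set: 'rV[R]_n.+1]].

Definition mse (R : realType) (n : nat)
    (sigma0 : probability (borelRV R n) R) (S1 : set (borelRV R n)) : \bar R :=
  (cluster_cost (rho sigma0) S1
   + cluster_cost (rho sigma0) (@supp R n `\` S1))%E.

(* mse is finite because rho has bounded support, so fine loses nothing. *)
Definition mse_cut (R : realType) (n : nat) (sigma0 : probability (borelRV R n) R)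
    (a : R) : R :=
  fine (mse sigma0
    [set x : borelRV R n | supp x /\ (x : 'rV[R]_n.+1) ord0 ord0 <= - a]).

(* Main.v *)
Require Import Defs.
From HB Require Import structures.
From mathcomp Require Import all_boot all_order all_algebra.
From mathcomp Require Import all_classical all_reals all_analysis.
From mathcomp Require Import measurable_realfun ring lra.

Set Implicit Arguments.
Unset Strict Implicit.
Unset Printing Implicit Defensive.

Import Order.TTheory GRing.Theory Num.Theory.
Import numFieldNormedType.Exports.

Local Open Scope classical_set_scope.
Local Open Scope ring_scope.

(** Let t be the first coordinate of a uniform point of the unit sphere of
    R^(n+1), and put u(s) = P(t > s), K(s) = E[t; t > s] and
    N(s) = 1 - u(s) + K(s) = E[1 - t; t <= s].

    The hyperplane x_0 = - a cuts a cap off the sphere centred at - e_1 and leaves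
    the other sphere whole. By symmetry both barycentres lie on the axis, and
    completing the square in the centre of each part gives ([mse_cutE])
<<
      E(n, a) = 2 - N(s)^2 / (1 - u(s)^2),      s = 1 - a.
>>
    So the theorem says that the quotient, called the gain, is strictly increasing
    in s on (-1, 1] ([gain_derive_gt0], [gain_lt1], [gain1]). If t has density f,
    then u' = - f and K' = - s f, so the derivative of the gain is positive as soon
    as ([gain_criterion])
<<
      u N < (1 - s) (1 - u^2).
>>
    For s <= 0 this holds because K <= 1 - u. For s > 0 it follows from
    u <= (1 - s) / 2 ([tail_le_chord]), which expresses that u is convex on [0, 1]
    with u(0) <= 1/2 and u(1) = 0, that is, that f is nonincreasing there.

    It remains to know that t has a positive density that is nonincreasing on
    [0, 1), and this has to come from the rotation invariance of the measure.
    Differentiating the average of p(t) x_j along the rotations in the plane of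
    the coordinates 0 and j, and summing over j, gives Stein's identity ([stein])
<<
      E[(1 - t^2) p'(t)] = n E[t p(t)].
>>
    Applied to p = the square of the ramp (t - v)^+ and then differentiated in v,
    it becomes E[1 - t^2; t > v] = n E[t (t - v)^+] ([tail_stein]). The right-hand
    side is Lipschitz in v, so the law has no atoms in (-1, 1); differentiating
    once more gives (1 - v^2) f(v) = n K(v), hence K' = - n v K / (1 - v^2). This
    linear equation, with K(0) > 0, gives the positivity of K and f, and the
    monotonicity of f ([ratio_is_derive]). Derivatives are obtained throughout from
    bounds with a quadratic error ([is_derive_quadratic]), so that no integral has
    to be differentiated under the integral sign. *)

(** * Averages over the unit sphere *)

Section average.
Context {R : realType} {n : nat}.
Implicit Types (f g h : 'rV[R]_n.+1 -> R) (x : 'rV[R]_n.+1).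

Lemma measurable_coord i :
  measurable_fun [set: borelRV R n] (fun x : 'rV[R]_n.+1 => x ord0 i).
Proof.
apply: (@measurability _ _ (borelRV R n) _ _ _ _ (RGenOpens.measurableE R)).
move=> _ [_ [a [b ->]] <-]; rewrite setTI; apply: sub_sigma_algebra.
apply: (@open_comp 'rV[R]_n.+1 R (fun x => x ord0 i)); last exact: interval_open.
by move=> x _; exact: coord_continuous.
Qed.

Lemma enorm_sqrB x (c : 'rV[R]_n.+1) :
  enorm (x - c) ^+ 2 = \sum_i (x ord0 i - c ord0 i) ^+ 2.
Proof.
rewrite /enorm sqr_sqrtr; last by apply: sumr_ge0 => i _; exact: sqr_ge0.
by apply: eq_bigr => i _; rewrite !mxE.
Qed.

Lemma measurable_enorm2B (c : 'rV[R]_n.+1) :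
  measurable_fun [set: borelRV R n] (fun x : 'rV[R]_n.+1 => enorm (x - c) ^+ 2).
Proof.
rewrite (_ : (fun x => _) = fun x => \sum_i (x ord0 i - c ord0 i) ^+ 2).
  apply: (@measurable_sum _ (borelRV R n)) => i.
  by apply/measurable_funX/measurable_funB; [exact: measurable_coord|].
by apply/funext => x; rewrite enorm_sqrB.
Qed.

Lemma sphere0E x : sphere 0 x <-> \sum_i x ord0 i ^+ 2 = 1.
Proof.
rewrite /sphere /= scale0r subr0 /enorm; split=> [s1|->]; last exact: sqrtr1.
rewrite -[LHS]sqr_sqrtr ?s1 ?expr1n//.
by apply: sumr_ge0 => i _; exact: sqr_ge0.
Qed.

Lemma measurable_sphere a : measurable (@sphere R n a).
Proof.
rewrite (_ : sphere a = [set: borelRV R n] `&`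
    (fun x : 'rV[R]_n.+1 => enorm (x - a *: e1 R n) ^+ 2) @^-1` [set 1]).
  by apply: (@measurable_enorm2B (a *: e1 R n)) => //.
rewrite setTI; apply/seteqP; split => x /=; rewrite /sphere /=.
  by move=> ->; rewrite expr1n.
move/eqP; rewrite sqrf_eq1 => /orP[/eqP//|/eqP xN1].
by have := sqrtr_ge0 (\sum_i (x - a *: e1 R n) ord0 i ^+ 2);
  rewrite -/(enorm _) xN1 oppr_ge0 ler10.
Qed.

(** Boundedness is asked only on the sphere, which carries the measure; this is
    what lets polynomials in the coordinates be test functions. *)
Definition testfun h := measurable_fun [set: borelRV R n] h /\
  exists M, forall x, sphere 0 x -> `|h x| <= M.

Lemma testfun_cst c : testfun (fun=> c).
Proof. by split; [exact: measurable_cst|exists `|c|]. Qed.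

Lemma testfunD f g : testfun f -> testfun g -> testfun (fun x => f x + g x).
Proof.
move=> [mf [M Mf]] [mg [N Ng]]; split; first exact: measurable_funD.
exists (M + N) => x Sx.
by rewrite (le_trans (ler_normD _ _))// lerD ?Mf ?Ng.
Qed.

Lemma testfunM f g : testfun f -> testfun g -> testfun (fun x => f x * g x).
Proof.
move=> [mf [M Mf]] [mg [N Ng]]; split; first exact: measurable_funM.
by exists (M * N) => x Sx; rewrite normrM ler_pM ?Mf ?Ng.
Qed.

Lemma testfunN f : testfun f -> testfun (fun x => - f x).
Proof.
move=> [mf [M Mf]]; split; first exact: measurableT_comp.
by exists M => x Sx; rewrite normrN Mf.
Qed.

Lemma testfunX f k : testfun f -> testfun (fun x => f x ^+ k).
Proof.
move=> [mf [M Mf]]; split; first exact: measurable_funX.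
by exists (M ^+ k) => x Sx; rewrite normrX lerXn2r ?nnegrE ?Mf ?(le_trans _ (Mf _ Sx)).
Qed.

Lemma testfun_sum (I : Type) (s : seq I) (P : pred I) (F : I -> 'rV[R]_n.+1 -> R) :
  (forall i, testfun (F i)) -> testfun (fun x => \sum_(i <- s | P i) F i x).
Proof.
move=> nF; elim: s => [|i s IH].
  rewrite (_ : (fun x => _) = fun=> 0); first exact: testfun_cst.
  by apply/funext => x; rewrite big_nil.
have -> : (fun x => \sum_(j <- i :: s | P j) F j x) =
    if P i then (fun x => F i x + \sum_(j <- s | P j) F j x)
    else (fun x => \sum_(j <- s | P j) F j x).
  by apply/funext => x; rewrite big_cons; case: ifP.
by case: ifP => _ //; exact: testfunD.
Qed.

Lemma sphere_coord_le1 x i : sphere 0 x -> `|x ord0 i| <= 1.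
Proof.
move=> /sphere0E s1; rewrite -(@ler_pXn2r _ 2)// ?nnegrE// expr1n real_normK ?num_real//.
rewrite -s1 (bigD1 i)//= lerDl; apply: sumr_ge0 => j _; exact: sqr_ge0.
Qed.

Lemma testfun_coord i : testfun (fun x => x ord0 i).
Proof.
split; first exact: measurable_coord.
by exists 1 => x; exact: sphere_coord_le1.
Qed.

Lemma mulmxr_continuous (Q : 'M[R]_n.+1) :
  continuous (fun x : 'rV[R]_n.+1 => x *m Q).
Proof.
rewrite (_ : (fun x => _) = fun x => \sum_i x ord0 i *: row i Q); last first.
  by apply/funext => x; rewrite mulmx_sum_row.
apply: continuous_big => [z|i _].
  by apply: cvgD; [exact: cvg_fst|exact: cvg_snd].
move=> x; apply: (@cvgZr_tmp _ _ _ _ _ (fun y : 'rV[R]_n.+1 => y ord0 i)).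
  exact: (@nbhs_filter 'rV[R]_n.+1).
exact: (@coord_continuous R 1 n.+1 ord0 i x).
Qed.

Lemma measurable_mulmxr (Q : 'M[R]_n.+1) :
  measurable_fun [set: borelRV R n] (fun x : 'rV[R]_n.+1 => x *m Q : borelRV R n).
Proof.
apply: (@measurability _ _ _ (borelRV R n) _ _ (@open 'rV[R]_n.+1)) => //.
move=> _ [U oU <-]; rewrite setTI; apply: sub_sigma_algebra.
apply: (@open_comp 'rV[R]_n.+1 'rV[R]_n.+1 (fun x => x *m Q)) oU.
by move=> x _; exact: mulmxr_continuous.
Qed.

Lemma sphere_mulmxr (Q : 'M[R]_n.+1) x : Q *m Q^T = 1%:M ->
  sphere 0 (x *m Q) <-> sphere 0 x.
Proof.
move=> QQ; rewrite !sphere0E.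
have normE (y : 'rV[R]_n.+1) : \sum_i y ord0 i ^+ 2 = (y *m y^T) ord0 ord0.
  by rewrite mxE; apply: eq_bigr => i _; rewrite mxE expr2.
by rewrite !normE trmx_mul mulmxA -(mulmxA x) QQ mulmx1.
Qed.

Lemma testfun_mulmxr (Q : 'M[R]_n.+1) h : Q *m Q^T = 1%:M -> testfun h ->
  testfun (fun x => h (x *m Q)).
Proof.
move=> QQ [mh [M Mh]]; split.
  exact: (@measurableT_comp _ _ _ (borelRV R n) (borelRV R n) R h setT _ mh
    (measurable_mulmxr Q)).
by exists M => x /(sphere_mulmxr x QQ); exact: Mh.
Qed.

Lemma testfun_comp0 (p : R -> R) : measurable_fun [set: R] p ->
  (exists M, forall t, `|t| <= 1 -> `|p t| <= M) ->
  testfun (fun x => p (x ord0 ord0)).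
Proof.
move=> mp [M Mp]; split.
  exact: measurableT_comp mp (measurable_coord ord0).
by exists M => x /(sphere_coord_le1 ord0); exact: Mp.
Qed.

Section avg.
Variable sigma0 : probability (borelRV R n) R.

Definition avg h : R := \int[sigma0]_(x in sphere 0) h x.

Lemma testfun_integrable h : testfun h ->
  sigma0.-integrable (sphere 0) (EFin \o h).
Proof.
move=> [mh [M Mh]]; apply: measurable_bounded_integrable.
- exact: measurable_sphere.
- by rewrite (le_lt_trans (probability_le1 _ (measurable_sphere 0)))// ltry.
- exact: measurable_funS mh.
exists M; split; first exact: num_real.
by move=> r Mr x Sx; exact: le_trans (Mh _ Sx) (ltW Mr).
Qed.

Lemma avgD f g : testfun f -> testfun g -> avg (fun x => f x + g x) = avg f + avg g.
Proof.
by move=> nf ng; rewrite /avg RintegralD//;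
  [exact: measurable_sphere|exact: testfun_integrable..].
Qed.

Lemma avgZ c f : testfun f -> avg (fun x => c * f x) = c * avg f.
Proof.
by move=> nf; rewrite /avg RintegralZl//;
  [exact: measurable_sphere|exact: testfun_integrable].
Qed.

Lemma avg_le f g : testfun f -> testfun g -> (forall x, sphere 0 x -> f x <= g x) ->
  avg f <= avg g.
Proof.
by move=> nf ng fg; apply: le_Rintegral => //;
  [exact: measurable_sphere|exact: testfun_integrable..].
Qed.

Lemma eq_avg f g : (forall x, sphere 0 x -> f x = g x) -> avg f = avg g.
Proof. by move=> fg; apply: eq_Rintegral => x; rewrite inE; exact: fg. Qed.

Lemma avg_sum (I : Type) (s : seq I) (P : pred I) (F : I -> 'rV[R]_n.+1 -> R) :
  (forall i, testfun (F i)) ->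
  avg (fun x => \sum_(i <- s | P i) F i x) = \sum_(i <- s | P i) avg (F i).
Proof.
move=> nF; elim: s => [|i s IH].
  rewrite big_nil -[RHS](mul0r (avg (fun=> 0))) -avgZ; last exact: testfun_cst.
  by apply: eq_avg => x _; rewrite big_nil mul0r.
rewrite big_cons -IH; case: ifP => Pi; last first.
  by apply: eq_avg => x _; rewrite big_cons Pi.
rewrite -avgD//; last exact: testfun_sum.
by apply: eq_avg => x _; rewrite big_cons Pi.
Qed.

Hypothesis sigma0_unif : uniform_on_sphere sigma0.

Lemma avg_cst c : avg (fun=> c) = c.
Proof.
rewrite /avg Rintegral_cst; last exact: measurable_sphere.
by rewrite [X in fine X](_ : _ = 1%E) ?mulr1//; exact: sigma0_unif.1.
Qed.

(** Invariance of the measure of sets is invariance of the push-forward measure,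
    and rotations preserve the domain of integration. *)
Lemma avg_rotation (Q : 'M[R]_n.+1) h : rotation Q -> testfun h ->
  avg (fun x => h (x *m Q)) = avg h.
Proof.
move=> rQ nh; have [QQ _] := rQ; rewrite /avg /Rintegral; congr fine.
have [mh _] := nh.
have eS : sphere 0 = (fun x : 'rV[R]_n.+1 => x *m Q : borelRV R n) @^-1` sphere 0.
  by apply/seteqP; split => x /= /(sphere_mulmxr x QQ).
rewrite [in LHS]eS.
rewrite -(@integral_pushforward _ _ (borelRV R n) (borelRV R n) R
   (fun x : 'rV[R]_n.+1 => x *m Q) (measurable_mulmxr Q) sigma0 (sphere 0)
   (EFin \o h)).
- apply: eq_measure_integral; first exact: measurable_mulmxr.
  by move=> mQ A mA _; exact: (sigma0_unif.2 Q rQ A mA).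
- exact/measurable_EFinP.
- by rewrite -eS; apply: testfun_integrable; exact: testfun_mulmxr.
- exact: measurable_sphere.
Qed.
End avg.
End average.

(** * Rotations in a coordinate plane *)

Section plane_rotation.
Context {R : realType} {n : nat}.
Implicit Types (i j k : 'I_n.+1) (a b : R) (x : 'rV[R]_n.+1).

Let D i j : 'M[R]_n.+1 := delta_mx i i + delta_mx j j.
Let N i j : 'M[R]_n.+1 := delta_mx i j - delta_mx j i.

(** For a = cos and b = sin this is the rotation in the plane of the coordinates
    i and j, written with the projection D on that plane and the quarter turn N
    of it, so that products reduce to D D = D, D N = N D = N and N N = - D. *)
Definition plane_mx i j a b : 'M[R]_n.+1 := 1 + (a - 1) *: D i j + b *: N i j.

Let DD i j : i != j -> D i j * D i j = D i j.
Proof.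
move=> ij; have /negPf ji : j != i by rewrite eq_sym.
rewrite /D mulrDl !mulrDr -!mulmxE !mul_delta_mx_cond !eqxx (negPf ij) ji.
by rewrite !mulr1n !mulr0n addr0 add0r.
Qed.

Let DN i j : i != j -> D i j * N i j = N i j.
Proof.
move=> ij; have /negPf ji : j != i by rewrite eq_sym.
rewrite /D /N mulrDl !mulrBr -!mulmxE !mul_delta_mx_cond !eqxx (negPf ij) ji.
by rewrite !mulr1n !mulr0n subr0 add0r.
Qed.

Let ND i j : i != j -> N i j * D i j = N i j.
Proof.
move=> ij; have /negPf ji : j != i by rewrite eq_sym.
rewrite /D /N mulrBl !mulrDr -!mulmxE !mul_delta_mx_cond !eqxx (negPf ij) ji.
by rewrite !mulr1n !mulr0n addr0 add0r.
Qed.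

Let NN i j : i != j -> N i j * N i j = - D i j.
Proof.
move=> ij; have /negPf ji : j != i by rewrite eq_sym.
rewrite /D /N mulrBl !mulrBr -!mulmxE !mul_delta_mx_cond !eqxx (negPf ij) ji.
by rewrite !mulr1n !mulr0n subr0 sub0r opprD.
Qed.

Lemma plane_mxM i j a b c d : i != j ->
  plane_mx i j a b * plane_mx i j c d =
  plane_mx i j (a * c - b * d) (a * d + b * c).
Proof.
move=> ij; rewrite /plane_mx !mulrDl !mulrDr !mul1r !mulr1.
rewrite -!scalerAl -!scalerAr DD// DN// ND// NN// scalerN !scalerA.
by apply/matrixP => k l; rewrite !mxE; ring.
Qed.

Lemma plane_mx_tr i j a b : (plane_mx i j a b)^T = plane_mx i j a (- b).
Proof.
apply/matrixP => k l; rewrite !mxE eq_sym mulNr -mulrN opprB.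
by rewrite ![(l == _) && _]andbC.
Qed.

Lemma plane_mx1 i j : plane_mx i j 1 0 = 1.
Proof. by rewrite /plane_mx subrr !scale0r !addr0. Qed.

Lemma plane_mx_orthogonal i j a b : i != j -> a ^+ 2 + b ^+ 2 = 1 ->
  plane_mx i j a b *m (plane_mx i j a b)^T = 1%:M.
Proof.
move=> ij ab; rewrite plane_mx_tr mulmxE plane_mxM//.
have -> : a * a - b * - b = 1 by rewrite -ab; ring.
by have -> : a * - b + b * a = 0; [ring|rewrite plane_mx1].
Qed.

(** The angle is doubled so that the matrix is a square: an orthogonal matrix has
    determinant 1 or -1, hence its square has determinant 1. *)
Lemma rotation_plane_mx i j a b : i != j -> a ^+ 2 + b ^+ 2 = 1 ->
  rotation (plane_mx i j (a ^+ 2 - b ^+ 2) (2 * a * b)).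
Proof.
move=> ij ab; split.
  apply: plane_mx_orthogonal => //.
  transitivity ((a ^+ 2 + b ^+ 2) ^+ 2); first by ring.
  by rewrite ab expr1n.
rewrite (_ : plane_mx _ _ _ _ = plane_mx i j a b *m plane_mx i j a b); last first.
  by rewrite mulmxE plane_mxM//; congr plane_mx; ring.
have := congr1 determinant (plane_mx_orthogonal ij ab).
by rewrite !det_mulmx det_tr det1.
Qed.

Lemma mulmx_plane i j a b x k : (x *m plane_mx i j a b) ord0 k =
  x ord0 k + (a - 1) * (x ord0 i *+ (k == i) + x ord0 j *+ (k == j))
  + b * (x ord0 i *+ (k == j) - x ord0 j *+ (k == i)).
Proof.
have xd l m : (x *m delta_mx l m) ord0 k = x ord0 l *+ (k == m).
  rewrite mxE (bigD1 l)//= big1 ?addr0 => [|p /negPf pl]; last first.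
    by rewrite mxE pl mulr0.
  by rewrite mxE eqxx/=; case: (k == m); rewrite ?mulr1 ?mulr0.
rewrite /plane_mx /D /N !mulmxDr mulmx1 -!scalemxAr mulmxDr mulmxBr.
have eD (y z : 'rV[R]_n.+1) : (y + z) ord0 k = y ord0 k + z ord0 k by rewrite mxE.
have eN (y : 'rV[R]_n.+1) : (- y) ord0 k = - y ord0 k by rewrite mxE.
have eZ c (y : 'rV[R]_n.+1) : (c *: y) ord0 k = c * y ord0 k by rewrite mxE.
by rewrite !(eD, eZ, eN) !xd.
Qed.
End plane_rotation.

(** * Consequences of rotation invariance *)

Lemma le_of_eps {R : realType} (C x y : R) :
  (forall e, 0 < e <= 1 -> x <= y + C * e) -> x <= y.
Proof.
move=> H; apply/ler_addgt0Pr => e e0.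
have C0 : 0 < `|C| + 1 by rewrite ltr_wpDl.
pose d := Num.min 1 (e / (`|C| + 1)).
have d01 : 0 < d <= 1 by rewrite /d lt_min ltr01 ge_min lexx /= divr_gt0.
apply: (le_trans (H _ d01)); rewrite lerD2l.
apply: (@le_trans _ _ ((`|C| + 1) * d)).
  by case/andP: d01 => d0 _; rewrite ler_pM2r//; have := ler_norm C; lra.
by rewrite mulrC -ler_pdivlMr// /d ge_min lexx orbT.
Qed.

Lemma norm_le_eps_eq0 {R : realType} (C X : R) :
  (forall e, 0 < e <= 1 -> `|X| <= C * e) -> X = 0.
Proof.
move=> XC; apply/eqP; rewrite -normr_le0; apply: (@le_of_eps _ C) => e /XC.
by rewrite add0r.
Qed.

Section invariance.
Context {R : realType} {n : nat}.
Variable sigma0 : probability (borelRV R n) R.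
Hypothesis sigma0_unif : uniform_on_sphere sigma0.
Local Notation avg := (avg sigma0).
Implicit Types (x : 'rV[R]_n.+1) (h : 'rV[R]_n.+1 -> R) (p dp : R -> R).

Lemma avg_norm_le h (C : R) : testfun h -> (forall x, sphere 0 x -> `|h x| <= C) ->
  `|avg h| <= C.
Proof.
move=> nh hC; have nc c : testfun (fun=> c : R) := @testfun_cst R n c.
rewrite ler_norml; apply/andP; split.
  rewrite -(avg_cst sigma0_unif (- C)); apply: avg_le => // x /hC.
  by rewrite ler_norml => /andP[].
rewrite -[leRHS](avg_cst sigma0_unif); apply: avg_le => // x /hC.
by rewrite ler_norml => /andP[].
Qed.

(** The half turn in the plane of i and j changes the signs of these two
    coordinates only. *)
Lemma avg_flip (i j : 'I_n.+1) h : i != j -> testfun h ->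
  avg (fun x => h (x *m plane_mx i j (-1) 0)) = avg h.
Proof.
move=> ij nh; apply: avg_rotation => //.
have := @rotation_plane_mx R n i j 0 1 ij.
have -> : 0 ^+ 2 + 1 ^+ 2 = 1 :> R by ring.
have -> : 0 ^+ 2 - 1 ^+ 2 = - 1 :> R by ring.
by have -> : 2 * 0 * 1 = 0 :> R; [ring|exact].
Qed.

Lemma avg_even p : (0 < n)%N -> testfun (fun x : 'rV[R]_n.+1 => p (x ord0 ord0)) ->
  avg (fun x => p (- x ord0 ord0)) = avg (fun x => p (x ord0 ord0)).
Proof.
move=> n0 np; have om : ord0 != ord_max :> 'I_n.+1.
  by rewrite -val_eqE /= eq_sym -lt0n.
rewrite -(avg_flip om np); apply: eq_avg => x _.
by rewrite mulmx_plane eqxx (negPf om); congr p; rewrite mulr1n !mulr0n; ring.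
Qed.

(** A half turn in the plane of j and a third coordinate k fixes the first
    coordinate and changes the sign of the j-th one; such a k exists in dimension
    at least 3. *)
Lemma avg_coord_odd p (j : 'I_n.+1) : (1 < n)%N -> j != ord0 ->
  testfun (fun x : 'rV[R]_n.+1 => p (x ord0 ord0)) ->
  avg (fun x => p (x ord0 ord0) * x ord0 j) = 0.
Proof.
move=> n1 j0 np.
have [k kj k0] : exists2 k : 'I_n.+1, k != j & k != ord0.
  have l1 : (1 < n.+1)%N by rewrite ltnS (ltn_trans _ n1).
  have l2 : (2 < n.+1)%N by [].
  have [j1|j1] := eqVneq j (Ordinal l1).
    by exists (Ordinal l2); rewrite // j1.
  by exists (Ordinal l1); rewrite // eq_sym.
have nh : testfun (fun x : 'rV[R]_n.+1 => p (x ord0 ord0) * x ord0 j).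
  by apply: testfunM => //; exact: testfun_coord.
suff : avg (fun x => p (x ord0 ord0) * x ord0 j) =
    - avg (fun x => p (x ord0 ord0) * x ord0 j) by lra.
rewrite -{1}(avg_flip kj nh) -[RHS]mulN1r -avgZ//; apply: eq_avg => x _.
rewrite !mulmx_plane eqxx [j == k]eq_sym (negPf kj).
rewrite [ord0 == k]eq_sym (negPf k0) [ord0 == j]eq_sym (negPf j0).
by rewrite mulr1n !mulr0n !addr0 subr0 !mulr0 !addr0; ring.
Qed.

(** First-order expansion of p(x_0) x_j under a rotation by a small angle: u and w
    stand for x_0 and x_j, P and H for the values at u of p and of its
    derivative, Y for the value of p at the rotated first coordinate u + d. The
    error is quadratic in b, the sine of half the angle. *)
Lemma rotation_expansion (M a b u w P Y H : R) :
  0 < b <= 1 -> 0 <= a -> a ^+ 2 + b ^+ 2 = 1 -> `|u| <= 1 -> `|w| <= 1 ->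
  `|P| <= M -> `|H| <= M ->
  let c := a ^+ 2 - b ^+ 2 in let s := 2 * a * b in
  let d := c * u - s * w - u in
  `|Y - P - H * d| <= M * d ^+ 2 ->
  `|Y * (s * u + c * w) - P * w - 2 * b * (u * P - w ^+ 2 * H)|
    <= 56 * M * b ^+ 2.
Proof.
move=> /andP[b0 b1] a0 ab u1 w1 PM HM c s d Yd.
have bm (x y A B : R) : `|x| <= A -> `|y| <= B -> `|x * y| <= A * B.
  by move=> xA yB; rewrite normrM ler_pM.
have M0 : 0 <= M by exact: le_trans PM.
have b0' := ltW b0.
have a1 : a <= 1 by nra.
have aa : a ^+ 2 <= a by rewrite expr2 ler_piMr.
have [a1b a1b'] : 0 <= 1 - a /\ 1 - a <= b ^+ 2 by split; lra.
have dE : d = - 2 * a * b * w - 2 * b ^+ 2 * u.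
  have a2 : a ^+ 2 = 1 - b ^+ 2 by lra.
  by rewrite /d /c /s a2; ring.
have cE : c = 1 - 2 * b ^+ 2 by rewrite /c; lra.
have s2b : `|s| <= 2 * b by rewrite /s ger0_norm; nra.
have c1 : `|c| <= 1 by rewrite cE ler_norml; apply/andP; split; nra.
have c2 : `|c - 1| <= 2 * b ^+ 2.
  by rewrite cE ler_norml; apply/andP; split; nra.
have b2 : b ^+ 2 <= b by rewrite expr2 ler_piMr// ltW.
have d4 : `|d| <= 4 * b.
  rewrite dE (le_trans (ler_normB _ _))//.
  have := bm (- 2 * a * b) w (2 * b) 1.
  have := bm (2 * b ^+ 2) u (2 * b) 1.
  rewrite !mulr1 ![`|_ * b ^+ 2|]ger0_norm ?(mulr_ge0, sqr_ge0)//.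
  rewrite -/s !mulNr normrN => /(_ _ u1) h1 /(_ _ w1) h2; rewrite -/s.
  by rewrite (le_trans (lerD (h2 s2b) (h1 _)))//; lra.
have s1 : `|s| <= 1.
  have ab0 : 0 <= (a - b) ^+ 2 := sqr_ge0 _.
  have s0 : 0 <= s by rewrite /s !mulr_ge0// ltW.
  have -> : `|s| = a ^+ 2 + b ^+ 2 - (a - b) ^+ 2 by rewrite ger0_norm// /s; ring.
  by lra.
have z2 : `|s * u + c * w| <= 2.
  rewrite (le_trans (ler_normD _ _))// (_ : 2 = 1 * 1 + 1 * 1); last by ring.
  by rewrite lerD// bm.
have e4 : `|d + 2 * b * w| <= 4 * b ^+ 2.
  have -> : d + 2 * b * w = 2 * b * (1 - a) * w - 2 * b ^+ 2 * u.
    by rewrite dE; ring.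
  rewrite (le_trans (ler_normB _ _))//.
  have -> : 4 * b ^+ 2 = 2 * b ^+ 2 * 1 + 2 * b ^+ 2 * 1 by ring.
  apply: lerD; apply: (bm) => //; rewrite ger0_norm//; first by nra.
  - by rewrite mulr_ge0//; lra.
  - by rewrite mulr_ge0// sqr_ge0.
have -> : Y * (s * u + c * w) - P * w - 2 * b * (u * P - w ^+ 2 * H) =
  P * (2 * b * (a - 1) * u - 2 * b ^+ 2 * w)
  + H * (d * s * u + d * (c - 1) * w + (d + 2 * b * w) * w)
  + (Y - P - H * d) * (s * u + c * w).
  by rewrite cE /s; ring.
have -> : 56 * M * b ^+ 2 = M * (4 * b ^+ 2) + M * (20 * b ^+ 2)
   + (M * (16 * b ^+ 2)) * 2 by ring.
rewrite (le_trans (ler_normD _ _))// lerD//.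
  rewrite (le_trans (ler_normD _ _))// lerD//; apply: (bm) => //.
    rewrite (le_trans (ler_normB _ _))//.
    have -> : 4 * b ^+ 2 = 2 * b ^+ 2 * 1 + 2 * b ^+ 2 * 1 by ring.
    apply: lerD; apply: (bm) => //.
      by rewrite ler0_norm; nra.
    by rewrite ger0_norm// mulr_ge0// sqr_ge0.
  have -> : 20 * b ^+ 2 = 4 * b * (2 * b) * 1 + 4 * b * (2 * b) * 1
      + 4 * b ^+ 2 * 1 by ring.
  rewrite (le_trans (ler_normD _ _))// lerD//; last exact: bm.
  rewrite (le_trans (ler_normD _ _))// lerD//; apply: (bm) => //; apply: (bm) => //.
  by rewrite (le_trans c2)// ler_pM2l.
apply: (bm) => //; apply: (le_trans Yd); rewrite ler_wpM2l//.
rewrite (_ : 16 * b ^+ 2 = (4 * b) ^+ 2); last by ring.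
by rewrite -(@real_normK _ d) ?num_real// lerXn2r ?nnegrE//; lra.
Qed.

Section stein.
Variables (p dp : R -> R) (M : R).
Hypotheses (mp : measurable_fun [set: R] p) (mdp : measurable_fun [set: R] dp).
Hypothesis pM : forall t, `|t| <= 1 -> `|p t| <= M.
Hypothesis dpM : forall t, `|t| <= 1 -> `|dp t| <= M.
Hypothesis p_dp : forall s t, `|s| <= 1 -> `|t| <= 1 ->
  `|p s - p t - dp t * (s - t)| <= M * (s - t) ^+ 2.

Let np : testfun (fun x : 'rV[R]_n.+1 => p (x ord0 ord0)).
Proof. by apply: testfun_comp0 => //; exists M. Qed.

Let ndp : testfun (fun x : 'rV[R]_n.+1 => dp (x ord0 ord0)).
Proof. by apply: testfun_comp0 => //; exists M. Qed.

(** The average of p(x_0) x_j does not change under a rotation in the plane of 0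
    and j. Its derivative with respect to the angle therefore vanishes, and at
    angle zero this derivative is the difference of the two sides. Working with
    a quadratic error bound instead of a derivative under the integral allows p
    whose derivative is merely Lipschitz. *)
Lemma stein_coord (j : 'I_n.+1) : j != ord0 ->
  avg (fun x => x ord0 ord0 * p (x ord0 ord0)) =
  avg (fun x => x ord0 j ^+ 2 * dp (x ord0 ord0)).
Proof.
move=> j0; have nx (i : 'I_n.+1) := @testfun_coord R n i.
pose X x := x ord0 ord0 * p (x ord0 ord0) + -1 * (x ord0 j ^+ 2 * dp (x ord0 ord0)).
have nX2 : testfun (fun x => x ord0 j ^+ 2 * dp (x ord0 ord0)).
  by apply: testfunM => //; apply: testfunX.
have nX1 : testfun (fun x => x ord0 ord0 * p (x ord0 ord0)) by exact: testfunM.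
have nX : testfun X.
  by apply: testfunD => //; apply: testfunM => //; exact: testfun_cst.
suff : avg X = 0 by rewrite /X avgD ?avgZ//; [lra|apply: testfunM => //; exact: testfun_cst].
apply: (@norm_le_eps_eq0 _ (28 * M)) => b /andP[b0 b1].
(* a and b are the cosine and the sine of half the rotation angle. *)
pose a := Num.sqrt (1 - b ^+ 2).
have a0 : 0 <= a := sqrtr_ge0 _.
have ab : a ^+ 2 + b ^+ 2 = 1 by rewrite sqr_sqrtr ?subrK// subr_ge0; nra.
have ij : ord0 != j :> 'I_n.+1 by rewrite eq_sym.
have rQ := rotation_plane_mx ij ab; have [QQ _] := rQ.
set c := a ^+ 2 - b ^+ 2 in rQ QQ *; set s := 2 * a * b in rQ QQ *.
have Q0 x : (x *m plane_mx ord0 j c s) ord0 ord0 = c * x ord0 ord0 - s * x ord0 j.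
  by rewrite mulmx_plane eqxx [_ == j]eq_sym (negPf j0) !mulr1n !mulr0n; ring.
have Qj x : (x *m plane_mx ord0 j c s) ord0 j = s * x ord0 ord0 + c * x ord0 j.
  by rewrite mulmx_plane eqxx (negPf j0) !mulr1n !mulr0n; ring.
pose h x := p (x ord0 ord0) * x ord0 j.
have nh : testfun h by exact: testfunM.
have nhQ := testfun_mulmxr QQ nh.
have nB : testfun (fun x => - h x + (- (2 * b)) * X x).
  by apply: testfunD; [exact: testfunN|apply: testfunM => //; exact: testfun_cst].
pose Z x := h (x *m plane_mx ord0 j c s) + (- h x + (- (2 * b)) * X x).
have nZ : testfun Z by exact: testfunD.
have ZE : avg Z = - (2 * b) * avg X.
  rewrite /Z avgD// avg_rotation// avgD ?avgZ//; last 2 first.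
  - exact: testfunN.
  - by apply: testfunM => //; exact: testfun_cst.
  rewrite (_ : avg (fun x => - h x) = - avg h); first by ring.
  by rewrite -mulN1r -avgZ//; apply: eq_avg => x _; rewrite mulN1r.
have Zb x : sphere 0 x -> `|Z x| <= 56 * M * b ^+ 2.
  move=> Sx; rewrite /Z /h Q0 Qj /X.
  have x1 := sphere_coord_le1 ord0 Sx.
  rewrite [X in `|X|](_ : _ = p (c * x ord0 ord0 - s * x ord0 j) *
    (s * x ord0 ord0 + c * x ord0 j) - p (x ord0 ord0) * x ord0 j -
    2 * b * (x ord0 ord0 * p (x ord0 ord0) - x ord0 j ^+ 2 * dp (x ord0 ord0)));
    last by ring.
  apply: rotation_expansion => //; rewrite ?b0 ?b1//.
  - exact: sphere_coord_le1.
  - exact: pM.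
  - exact: dpM.
  apply: p_dp => //; rewrite -Q0; apply: sphere_coord_le1.
  exact/(sphere_mulmxr x QQ).
have := avg_norm_le nZ Zb.
rewrite ZE normrM normrN [X in X * _]gtr0_norm ?mulr_gt0// => le1.
rewrite -(ler_pM2l (_ : 0 < 2 * b)) ?mulr_gt0// (le_trans le1)//.
by rewrite le_eqVlt; apply/orP; left; apply/eqP; ring.
Qed.

(** Sum of the previous identity over all j other than 0: on the sphere the squares
    of these coordinates add up to 1 - x_0^2. This identity characterises the
    law of x_0. *)
Lemma stein :
  avg (fun x => (1 - x ord0 ord0 ^+ 2) * dp (x ord0 ord0)) =
  n%:R * avg (fun x => x ord0 ord0 * p (x ord0 ord0)).
Proof.
transitivity (avg (fun x => \sum_(j | j != ord0) x ord0 j ^+ 2 * dp (x ord0 ord0))).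
  apply: eq_avg => x /sphere0E; rewrite (bigD1 ord0)//= -mulr_suml => <-.
  by rewrite addrAC subrr add0r.
rewrite avg_sum; last first.
  by move=> i; exact: (testfunM (testfunX 2 (testfun_coord i)) ndp).
rewrite (eq_bigr (fun=> avg (fun x => x ord0 ord0 * p (x ord0 ord0)))); last first.
  by move=> j j0; rewrite -stein_coord.
by rewrite sumr_const cardC1 card_ord mulr_natl.
Qed.
End stein.
End invariance.

(** * The law of the first coordinate *)

Section test_functions.
Context {R : realType}.
Implicit Types (p q : R -> R) (t v : R).

Definition testfun1 p := measurable_fun [set: R] p /\
  exists M, forall t, `|t| <= 1 -> `|p t| <= M.

Lemma testfun1_id : testfun1 (fun t => t).
Proof. by split; [exact: measurable_id|exists 1]. Qed.

Lemma testfun1_cst c : testfun1 (fun=> c).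
Proof. by split; [exact: measurable_cst|exists `|c|]. Qed.

Lemma testfun1D p q : testfun1 p -> testfun1 q -> testfun1 (fun t => p t + q t).
Proof.
move=> [mp [M pM]] [mq [N qN]]; split; first exact: measurable_funD.
by exists (M + N) => t t1; rewrite (le_trans (ler_normD _ _))// lerD ?pM ?qN.
Qed.

Lemma testfun1M p q : testfun1 p -> testfun1 q -> testfun1 (fun t => p t * q t).
Proof.
move=> [mp [M pM]] [mq [N qN]]; split; first exact: measurable_funM.
by exists (M * N) => t t1; rewrite normrM ler_pM ?pM ?qN.
Qed.

Lemma testfun1N p : testfun1 p -> testfun1 (fun t => - p t).
Proof.
move=> [mp [M pM]]; split; first exact: measurableT_comp.
by exists M => t t1; rewrite normrN pM.
Qed.

Lemma testfun1X p k : testfun1 p -> testfun1 (fun t => p t ^+ k).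
Proof.
move=> [mp [M pM]]; split; first exact: measurable_funX.
by exists (M ^+ k) => t t1; rewrite normrX lerXn2r ?nnegrE ?pM ?(le_trans _ (pM _ t1)).
Qed.

Lemma testfun1_max p q : testfun1 p -> testfun1 q ->
  testfun1 (fun t => Num.max (p t) (q t)).
Proof.
move=> [mp [M pM]] [mq [N qN]]; split; first exact: measurable_maxr.
exists (Num.max M N) => t t1; rewrite le_max; case: (leP (p t) (q t)) => _.
  by rewrite qN// orbT.
by rewrite pM.
Qed.

Lemma testfun1_bool (b : R -> bool) : measurable_fun [set: R] b ->
  testfun1 (fun t => (b t)%:R).
Proof.
move=> mb; split; last by exists 1 => t _; case: (b t); rewrite ?normr1 ?normr0.
rewrite (_ : (fun t => _) = fun t => if b t then 1 else 0); last first.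
  by apply/funext => t; case: (b t).
by apply: measurable_fun_ifT => //; exact: measurable_cst.
Qed.

Lemma testfun1_gt v : testfun1 (fun t => (v < t)%R%:R).
Proof.
by apply/testfun1_bool/measurable_fun_ltr; [
  exact: measurable_cst|exact: measurable_id].
Qed.

Lemma testfun1_le v : testfun1 (fun t => (t <= v)%R%:R).
Proof.
by apply/testfun1_bool/measurable_fun_ler; [
  exact: measurable_id|exact: measurable_cst].
Qed.

Lemma testfun1_opp p : testfun1 p -> testfun1 (fun t => p (- t)).
Proof.
move=> [mp [M pM]]; split; first exact: (measurableT_comp mp).
by exists M => t t1; apply: pM; rewrite normrN.
Qed.

Definition ramp v t : R := Num.max 0 (t - v).

Lemma testfun1_ramp v : testfun1 (ramp v).
Proof. rewrite /ramp; apply: testfun1_max; first exact: testfun1_cst.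
by apply: testfun1D; [exact: testfun1_id|exact: testfun1_cst]. Qed.

End test_functions.

Ltac solve_testfun1 := repeat first [exact: testfun1_id | exact: testfun1_cst
  | exact: testfun1_gt | exact: testfun1_le | exact: testfun1_ramp
  | apply: testfun1_max | apply: testfun1N | apply: testfun1X
  | apply: testfun1D | apply: testfun1M ].

Section law.
Context {R : realType} {n : nat}.
Variable sigma0 : probability (borelRV R n) R.
Hypothesis sigma0_unif : uniform_on_sphere sigma0.
Hypothesis n_gt0 : (0 < n)%N.
Implicit Types (p q : R -> R) (s t v w : R).

Lemma testfun_testfun1 p : testfun1 p -> testfun (fun x : 'rV[R]_n.+1 => p (x ord0 ord0)).
Proof. by move=> [mp bp]; exact: testfun_comp0. Qed.

(** The law of the first coordinate, given as the functional integrating against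
    it. *)
Definition law p := avg sigma0 (fun x => p (x ord0 ord0)).

Lemma lawD p q : testfun1 p -> testfun1 q -> law (fun t => p t + q t) = law p + law q.
Proof. by move=> ap aq; exact: avgD (testfun_testfun1 ap) (testfun_testfun1 aq). Qed.

Lemma lawZ c p : testfun1 p -> law (fun t => c * p t) = c * law p.
Proof. by move=> ap; exact: avgZ (testfun_testfun1 ap). Qed.

Lemma lawN p : testfun1 p -> law (fun t => - p t) = - law p.
Proof.
move=> ap; rewrite -mulN1r -lawZ//; congr law.
by apply/funext => t; rewrite mulN1r.
Qed.

Lemma law_cst c : law (fun=> c) = c.
Proof. exact: avg_cst. Qed.

Lemma law_le p q : testfun1 p -> testfun1 q -> (forall t, `|t| <= 1 -> p t <= q t) ->
  law p <= law q.
Proof.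
move=> ap aq pq; apply: avg_le; [exact: testfun_testfun1..|] => x Sx.
exact/pq/sphere_coord_le1.
Qed.

Lemma law_norm_le p q : testfun1 p -> testfun1 q ->
  (forall t, `|t| <= 1 -> `|p t| <= q t) ->
  `|law p| <= law q.
Proof.
move=> ap aq pq; rewrite ler_norml -lawN//.
apply/andP; split; apply: law_le => //; try solve_testfun1; move=> // t /pq;
  by rewrite ler_norml => /andP[].
Qed.

Lemma law_ge0 p : testfun1 p -> (forall t, `|t| <= 1 -> 0 <= p t) -> 0 <= law p.
Proof.
by move=> ap p0; rewrite -(law_cst 0); apply: law_le => //; solve_testfun1.
Qed.

Lemma eq_law p q : (forall t, `|t| <= 1 -> p t = q t) -> law p = law q.
Proof. by move=> pq; apply: eq_avg => x Sx; exact/pq/sphere_coord_le1. Qed.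

Lemma law_even p : testfun1 p -> law (fun t => p (- t)) = law p.
Proof. by move=> ap; apply: avg_even => //; exact: testfun_testfun1. Qed.

Lemma law_id : law (fun t => t) = 0.
Proof. by have := law_even testfun1_id; rewrite lawN; [lra|solve_testfun1]. Qed.

Lemma ramp_sqr_expansion v s t :
  `|ramp v s ^+ 2 - ramp v t ^+ 2 - 2 * ramp v t * (s - t)| <= (s - t) ^+ 2.
Proof.
rewrite /ramp; case: (leP 0 (s - v)) => sv; case: (leP 0 (t - v)) => tv;
  rewrite ler_norml; have := sqr_ge0 (s - t); have := sqr_ge0 (s - v).
- by move=> ? ?; apply/andP; split; lra.
- by move=> ? ?; apply/andP; split; nra.
- by have := sqr_ge0 (t - v) => ? ? ?; apply/andP; split; nra.
- by move=> ? ?; apply/andP; split; lra.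
Qed.

(** The squared ramp is the simplest function with Lipschitz derivative (twice the
    ramp) whose second derivative jumps at v, so that differentiating this
    identity in v localises it to the half-line beyond v. *)
Lemma ramp_sqr_stein v :
  2 * law (fun t => (1 - t ^+ 2) * ramp v t) =
  n%:R * law (fun t => t * ramp v t ^+ 2).
Proof.
have ar := testfun1_ramp v.
(* M bounds the squared ramp, its derivative and the Taylor error on [-1, 1]. *)
pose M := 2 * (1 + `|v|) ^+ 2.
have v0 : 0 <= `|v| by [].
have rM t : `|t| <= 1 -> 0 <= ramp v t <= 1 + `|v|.
  rewrite /ramp le_max lexx /= ge_max => t1; apply/andP; split; first lra.
  by move: t1 (ler_norm t) (ler_norm (- v)); rewrite normrN; lra.
transitivity (law (fun t => (1 - t ^+ 2) * (2 * ramp v t))).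
  rewrite -lawZ; first by apply: eq_law => t _; ring.
  by apply: testfun1M => //; solve_testfun1.
apply: (@stein R n sigma0 sigma0_unif (fun t => ramp v t ^+ 2)
  (fun t => 2 * ramp v t) M).
- exact: (testfun1X 2 ar).1.
- exact: (testfun1M (testfun1_cst 2) ar).1.
- move=> t /rM /andP[r0 r1]; rewrite ger0_norm ?sqr_ge0//.
  have : ramp v t ^+ 2 <= (1 + `|v|) ^+ 2 by rewrite lerXn2r ?nnegrE//; lra.
  by rewrite /M; have := sqr_ge0 (1 + `|v|); lra.
- move=> t /rM /andP[r0 r1]; rewrite ger0_norm; last lra.
  by rewrite /M; nra.
- move=> s t _ _; apply: (le_trans (ramp_sqr_expansion v s t)).
  by rewrite ler_peMl ?sqr_ge0// /M; nra.
Qed.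

(** Stein's identity for p(t) = t. *)
Lemma law_sqr : law (fun t => t ^+ 2) = (n.+1%:R)^-1.
Proof.
have : law (fun t => (1 - t ^+ 2) * 1) = n%:R * law (fun t => t * t).
  apply: (@stein R n sigma0 sigma0_unif (fun t => t) (fun=> 1) 1) => //.
  - by move=> t _; rewrite normr1.
  - by move=> s t _ _; rewrite mul1r subrr normr0 mul1r sqr_ge0.
have -> : (fun t => t * t) = (fun t : R => t ^+ 2) by apply/funext => t; rewrite expr2.
have -> : (fun t : R => (1 - t ^+ 2) * 1) = (fun t : R => 1 + -1 * t ^+ 2).
  by apply/funext => t; ring.
rewrite lawD ?lawZ ?law_cst; try by solve_testfun1.
move=> H; apply: (@mulfI _ n.+1%:R); first by rewrite pnatr_eq0.
by rewrite divff ?pnatr_eq0// -natr1 mulrDl mul1r -H; ring.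
Qed.

End law.
(** * Increments of the tail and of the tail mean *)

Section tail_derivative.
Context {R : realType} {n : nat}.
Variable sigma0 : probability (borelRV R n) R.
Hypothesis sigma0_unif : uniform_on_sphere sigma0.
Hypothesis n_gt0 : (0 < n)%N.
Implicit Types (p q : R -> R) (r s t v w x y : R).
Local Notation law := (law sigma0).

Lemma law_lin3 (a b c : R) p q g : testfun1 p -> testfun1 q -> testfun1 g ->
  law (fun t => a * p t + b * q t + c * g t) = a * law p + b * law q + c * law g.
Proof. by move=> ap aq ag; rewrite !lawD ?lawZ//; solve_testfun1. Qed.

Lemma law_lin3_ge0 (a b c : R) p q g : testfun1 p -> testfun1 q -> testfun1 g ->
  (forall t, `|t| <= 1 -> 0 <= a * p t + b * q t + c * g t) ->
  0 <= a * law p + b * law q + c * law g.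
Proof.
by move=> ap aq ag H; rewrite -law_lin3//; apply: law_ge0 => //; solve_testfun1.
Qed.

Lemma law_lin3_norm_le (a b c : R) p q g h :
  testfun1 p -> testfun1 q -> testfun1 g -> testfun1 h ->
  (forall t, `|t| <= 1 -> `|a * p t + b * q t + c * g t| <= h t) ->
  `|a * law p + b * law q + c * law g| <= law h.
Proof.
by move=> ap aq ag ah H; rewrite -law_lin3//; apply: law_norm_le => //; solve_testfun1.
Qed.

Definition tail v := law (fun t => (v < t)%R%:R).
Definition tmean v := law (fun t => t * (v < t)%R%:R).
Let J v := law (fun t => t * ramp v t).
Let P v := law (fun t => (1 - t ^+ 2) * (v < t)%R%:R).

Let aJ v : testfun1 (fun t => t * ramp v t).
Proof. by apply: testfun1M => //; solve_testfun1. Qed.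

Let aP v : testfun1 (fun t => (1 - t ^+ 2) * (v < t)%R%:R).
Proof. by solve_testfun1. Qed.

Lemma ramp_lipschitz x y t : x <= y -> 0 <= ramp x t - ramp y t <= y - x.
Proof.
by rewrite /ramp => xy; apply/andP; case: (leP 0 (t - x)) => ?;
  case: (leP 0 (t - y)) => ?; split; lra.
Qed.

(** Derivative in v of the identity for squared ramps. The left-hand side A(v) is
    an integral of ramps, so its difference quotient over [x, y] lies between - P(x)
    and - P(y); the right-hand side B is differentiable, with derivative
    - 2 J, up to a quadratic error. Comparing increments to the right and to the
    left of v gives the two inequalities. As J is Lipschitz, so is P, which
    rules out atoms of the law inside (-1, 1). *)
Lemma tail_stein v : P v = n%:R * J v.
Proof.
have n0 : 0 <= n%:R :> R by [].
pose A v := law (fun t => (1 - t ^+ 2) * ramp v t).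
pose B v := law (fun t => t * ramp v t ^+ 2).
have aA w : testfun1 (fun t => (1 - t ^+ 2) * ramp w t).
  by apply: testfun1M => //; solve_testfun1.
have aB w : testfun1 (fun t => t * ramp w t ^+ 2).
  by apply: testfun1M; [|apply: testfun1X]; solve_testfun1.
have AB w : 2 * A w = n%:R * B w := ramp_sqr_stein sigma0_unif w.
have t2 t : `|t| <= 1 -> 0 <= 1 - t ^+ 2.
  by rewrite ler_norml => /andP[? ?]; nra.
have PA1 x y : x <= y -> 0 <= 1 * A x + -1 * A y + - (y - x) * P y.
  move=> xy; apply: law_lin3_ge0 => // t /t2 t0.
  have -> : 1 * ((1 - t ^+ 2) * ramp x t) + -1 * ((1 - t ^+ 2) * ramp y t) +
    - (y - x) * ((1 - t ^+ 2) * (y < t)%R%:R) =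
    (1 - t ^+ 2) * (ramp x t - ramp y t - (y - x) * (y < t)%R%:R) by ring.
  rewrite mulr_ge0// /ramp; case: ltP => ?;
    case: (leP 0 (t - x)) => ?; case: (leP 0 (t - y)) => ?; rewrite ?mulr1 ?mulr0; lra.
have PA2 x y : x <= y -> 0 <= -1 * A x + 1 * A y + (y - x) * P x.
  move=> xy; apply: law_lin3_ge0 => // t /t2 t0.
  have -> : -1 * ((1 - t ^+ 2) * ramp x t) + 1 * ((1 - t ^+ 2) * ramp y t) +
    (y - x) * ((1 - t ^+ 2) * (x < t)%R%:R) =
    (1 - t ^+ 2) * ((y - x) * (x < t)%R%:R - (ramp x t - ramp y t)) by ring.
  rewrite mulr_ge0// /ramp; case: ltP => ?;
    case: (leP 0 (t - x)) => ?; case: (leP 0 (t - y)) => ?; rewrite ?mulr1 ?mulr0; lra.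
have BJ x y : `|1 * B y + -1 * B x + 2 * (y - x) * J x| <= (y - x) ^+ 2.
  rewrite -(law_cst sigma0_unif ((y - x) ^+ 2)).
  apply: law_lin3_norm_le => //; first by solve_testfun1.
  move=> t t1.
  have -> : 1 * (t * ramp y t ^+ 2) + -1 * (t * ramp x t ^+ 2) +
    2 * (y - x) * (t * ramp x t) = t * (ramp x (t + x - y) ^+ 2 -
    ramp x t ^+ 2 - 2 * ramp x t * ((t + x - y) - t)).
    have -> : ramp y t = ramp x (t + x - y) by rewrite /ramp; congr Num.max; ring.
    by ring.
  rewrite normrM -[leRHS]mul1r ler_pM//.
  apply: (le_trans (ramp_sqr_expansion _ _ _)).
  by rewrite le_eqVlt; apply/orP; left; apply/eqP; ring.
have JJ x y : x <= y -> `|J x - J y| <= y - x.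
  move=> xy; rewrite -(law_cst sigma0_unif (y - x)).
  have -> : J x - J y = 1 * J x + -1 * J y + 0 * J y by ring.
  apply: law_lin3_norm_le => //; first by solve_testfun1.
  move=> t t1; have /andP[r0 r1] := ramp_lipschitz t xy.
  have -> : 1 * (t * ramp x t) + -1 * (t * ramp y t) + 0 * (t * ramp y t) =
    t * (ramp x t - ramp y t) by ring.
  by rewrite normrM -[leRHS]mul1r ler_pM// ger0_norm.
apply/eqP; rewrite eq_le; apply/andP; split.
  apply: (@le_of_eps _ (3 / 2 * n%:R)) => e /andP[e0 e1].
  have h1 := PA1 (v - e) v; have h2 := BJ (v - e) v; have h3 := JJ (v - e) v.
  have {}h1 := h1 ltac:(lra); have {}h3 := h3 ltac:(lra).
  move: h2 h3; rewrite !ler_norml => /andP[h2 h2'] /andP[h3 h3'].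
  have ABv := AB v; have ABe := AB (v - e).
  have k1 : n%:R * (B (v - e) - B v) <= n%:R * (2 * e * J v + 3 * e ^+ 2).
    by rewrite ler_wpM2l//; nra.
  rewrite -(ler_pM2l e0); nra.
apply: (@le_of_eps _ (1 / 2 * n%:R)) => e /andP[e0 e1].
have h1 := PA2 v (v + e) ltac:(lra); have h2 := BJ v (v + e).
move: h2; rewrite !ler_norml => /andP[h2 h2'].
have ABv := AB v; have ABe := AB (v + e).
have k1 : n%:R * (2 * e * J v - e ^+ 2) <= n%:R * (B v - B (v + e)).
  by rewrite ler_wpM2l//; nra.
rewrite -(ler_pM2l e0); nra.
Qed.

(** The indicator of (x, y] when x <= y; increments of tails are averages of
    windows. *)
Definition window x y t : R := (x < t)%R%:R - (y < t)%R%:R.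

Lemma windowP x y t : x <= y ->
  (window x y t = 1 /\ x < t <= y) \/ window x y t = 0.
Proof.
rewrite /window => xy; case: (ltP x t) => xt; case: (ltP y t) => yt;
  rewrite ?subrr ?subr0 ?sub0r; [by right|by left| |by right].
by have := le_lt_trans (le_trans xt xy) yt; rewrite ltxx.
Qed.

Lemma testfun1_window x y : testfun1 (window x y).
Proof. by apply: testfun1D; [|apply: testfun1N]; solve_testfun1. Qed.

Lemma law_window p x y : testfun1 p ->
  law (fun t => p t * window x y t) =
  law (fun t => p t * (x < t)%R%:R) - law (fun t => p t * (y < t)%R%:R).
Proof.
move=> ap; rewrite -lawN -?lawD; try by solve_testfun1.
by apply: eq_law => t _; rewrite /window; ring.
Qed.

Lemma tail_window x y : tail x - tail y = law (window x y).
Proof.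
by rewrite /tail -lawN -?lawD; solve_testfun1.
Qed.

Lemma tmean_window x y : tmean x - tmean y = law (fun t => t * window x y t).
Proof. by rewrite law_window//; exact: testfun1_id. Qed.

Let P_window x y : P x - P y = law (fun t => (1 - t ^+ 2) * window x y t).
Proof. by rewrite law_window//; solve_testfun1. Qed.

Lemma tail_nonincreasing x y : x <= y -> tail y <= tail x.
Proof.
move=> xy; rewrite -subr_ge0 tail_window; apply: law_ge0 => //.
  exact: testfun1_window.
by move=> t _; have [[-> _]|->] := windowP t xy.
Qed.

Lemma tail_lipschitz r x y : r < 1 -> `|x| <= r -> `|y| <= r -> x <= y ->
  (1 - r ^+ 2) * (tail x - tail y) <= n%:R * (y - x).
Proof.
move=> r1; rewrite !ler_norml => /andP[xr xr'] /andP[yr yr'] xy.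
have aw := testfun1_window x y.
apply: (@le_trans _ _ (P x - P y)).
  rewrite P_window tail_window -lawZ//; apply: law_le => //; try by solve_testfun1.
  move=> t _; have [[-> /andP[xt ty]]|->] := windowP t xy; last by rewrite !mulr0.
  by rewrite !mulr1; nra.
rewrite !tail_stein -mulrBr ler_wpM2l//.
have -> : J x - J y = 1 * J x + -1 * J y + 0 * J y by ring.
rewrite -(law_cst sigma0_unif (y - x)).
apply: (le_trans (ler_norm _)); apply: law_lin3_norm_le => //; first by solve_testfun1.
move=> t t1; have /andP[r0 r1'] := ramp_lipschitz t xy.
have -> : 1 * (t * ramp x t) + -1 * (t * ramp y t) + 0 * (t * ramp y t) =
  t * (ramp x t - ramp y t) by ring.
by rewrite normrM -[leRHS]mul1r ler_pM// ger0_norm.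
Qed.

(** Infinitesimally: (1 - x^2) times the density at x equals n times the tail mean.
    It follows from P = n J, since the increment of P is that of the tail
    weighted by 1 - t^2 and the increment of J is - (y - x) times the tail mean. *)
Lemma tail_increment x y : `|x| <= 1 -> x <= y ->
  `|(1 - x ^+ 2) * (tail x - tail y) - n%:R * (y - x) * tmean x|
    <= (n%:R + 2) * (y - x) * (tail x - tail y).
Proof.
move=> x1 xy; have aw := testfun1_window x y.
have x1' := x1; move: x1'; rewrite ler_norml => /andP[xN1 xL1].
have n0 : 0 <= n%:R :> R by [].
have JK : `|1 * J x + -1 * J y + - (y - x) * tmean x| <= (y - x) * (tail x - tail y).
  rewrite /tmean tail_window -[leRHS]lawZ//; apply: law_lin3_norm_le => //; try by solve_testfun1.
  move=> t t1.
  have -> : 1 * (t * ramp x t) + -1 * (t * ramp y t) + - (y - x) * (t * (x < t)%R%:R) =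
    t * (ramp x t - ramp y t - (y - x) * (x < t)%R%:R) by ring.
  rewrite normrM -[leRHS]mul1r ler_pM//.
  rewrite /window /ramp ler_norml; apply/andP.
  case: ltP => ?; case: ltP => ?;
    case: (leP 0 (t - x)) => ?; case: (leP 0 (t - y)) => ?;
    rewrite ?subrr ?subr0 ?mulr1 ?mulr0; split; lra.
have PT : `|1 * (P x - P y) + - (1 - x ^+ 2) * (tail x - tail y) + 0 * (tail x - tail y)|
    <= 2 * (y - x) * (tail x - tail y).
  rewrite P_window tail_window -[leRHS]lawZ//; apply: law_lin3_norm_le => //; try by solve_testfun1.
  move=> t; rewrite ler_norml => /andP[tN1 tL1].
  have [[-> /andP[xt ty]]|->] := windowP t xy; last first.
    by rewrite !mulr0 !addr0 normr0.
  by rewrite !mulr1 ler_norml; apply/andP; split; nra.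
move: PT; rewrite !tail_stein => PT.
have -> : (1 - x ^+ 2) * (tail x - tail y) - n%:R * (y - x) * tmean x =
  n%:R * (1 * J x + -1 * J y + - (y - x) * tmean x) -
  (1 * (n%:R * J x - n%:R * J y) + - (1 - x ^+ 2) * (tail x - tail y)
    + 0 * (tail x - tail y)) by ring.
have -> : (n%:R + 2) * (y - x) * (tail x - tail y) =
  n%:R * ((y - x) * (tail x - tail y)) + 2 * (y - x) * (tail x - tail y) by ring.
by rewrite (le_trans (ler_normB _ _))// lerD// normrM ger0_norm// ler_wpM2l.
Qed.

Lemma tmean_increment x y : x <= y ->
  `|tmean x - tmean y - x * (tail x - tail y)| <= (y - x) * (tail x - tail y).
Proof.
move=> xy; have aw := testfun1_window x y.
have -> : tmean x - tmean y - x * (tail x - tail y) =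
  1 * (tmean x - tmean y) + - x * (tail x - tail y) + 0 * (tail x - tail y) by ring.
rewrite tmean_window tail_window -[leRHS]lawZ//; apply: law_lin3_norm_le => //; try by solve_testfun1.
move=> t _; have [[-> /andP[xt ty]]|->] := windowP t xy; last first.
  by rewrite !mulr0 !addr0 normr0.
by rewrite !mulr1 ler_norml; apply/andP; split; lra.
Qed.

End tail_derivative.

(** * The density of the first coordinate *)

Lemma is_derive_quadratic {R : realType} (g : R -> R) (x l C e : R) : 0 < e ->
  (forall y, `|y - x| < e -> `|g y - g x - l * (y - x)| <= C * (y - x) ^+ 2) ->
  is_derive x 1 g l.
Proof.
move=> e0 H.
have gl : (fun h => h^-1 *: ((g \o shift x) (h *: (1 : R)) - g x)) @ 0^' --> l.
  apply/cvgrPdist_le => eps eps0.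
  have C0 : 0 < `|C| + 1 by rewrite ltr_wpDl.
  pose d := Num.min e (eps / (`|C| + 1)).
  have d0 : 0 < d by rewrite lt_min e0 divr_gt0.
  near=> h.
  have h0 : h != 0 by near: h; exact: nbhs_dnbhs_neq.
  have hd : `|h| < d by near: h; exact: dnbhs0_lt.
  have := H (h + x); rewrite addrK => /(_ (lt_le_trans hd _)).
  rewrite ge_min lexx => /(_ isT) Hh.
  change (`|l - h^-1 * (g (h * 1 + x) - g x)| <= eps); rewrite mulr1.
  have -> : l - h^-1 * (g (h + x) - g x) = - (h^-1 * (g (h + x) - g x - l * h)).
    by field.
  rewrite normrN normrM normfV ler_pdivrMl ?normr_gt0// (le_trans Hh)//.
  rewrite -real_normK ?num_real// expr2 mulrCA ler_pM2l ?normr_gt0//.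
  apply: (@le_trans _ _ ((`|C| + 1) * `|h|)).
    by rewrite ler_wpM2r//; have := ler_norm C; lra.
  by rewrite mulrC -ler_pdivlMr// (le_trans (ltW hd))// ge_min lexx orbT.
by apply: DeriveDef; [apply/cvg_ex; exists l|exact/cvg_lim].
Unshelve. all: by end_near. Qed.

Lemma MVT_derive {R : realType} (g dg : R -> R) (a b : R) : a < b ->
  (forall x, a <= x <= b -> is_derive x 1 g (dg x)) ->
  exists2 c, a < c < b & g b - g a = dg c * (b - a).
Proof.
move=> ab H.
have [||c] := @MVT R g dg a b ab.
- by move=> x; rewrite in_itv /= => /andP[ax xb]; apply: H; rewrite !ltW.
- apply: derivable_within_continuous => x; rewrite in_itv /= => /H gx.
  exact: ex_derive.
by rewrite in_itv /= => cab gE; exists c.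
Qed.

Section density.
Context {R : realType} {n : nat}.
Variable sigma0 : probability (borelRV R n) R.
Hypothesis sigma0_unif : uniform_on_sphere sigma0.
Hypothesis n_gt1 : (1 < n)%N.
Implicit Types (r s t v w x y : R).
Local Notation u := (tail sigma0).
Local Notation K := (tmean sigma0).

Let n_gt0 : (0 < n)%N := ltnW n_gt1.

(** The value forced by Stein's identity, (1 - x^2) f(x) = n E[t; t > x]. *)
Definition density x : R := n%:R * tmean sigma0 x / (1 - x ^+ 2).

(** The increments estimated above are anchored at the left end of an interval; here
    they are re-anchored at x for y on either side, the change of anchor costing
    only quadratic terms because tail and tail mean are Lipschitz near x. *)
Lemma tail_tmean_expansion x : `|x| < 1 -> exists e C, 0 < e /\
  forall y, `|y - x| < e ->
  `|u y - u x - (- density x) * (y - x)| <= C * (y - x) ^+ 2 /\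
  `|K y - K x - (- (x * density x)) * (y - x)| <= C * (y - x) ^+ 2.
Proof.
move=> x1.
(* The ball of radius e around x stays within [-r, r], with r < 1. *)
pose r := (1 + `|x|) / 2; pose e := (1 - `|x|) / 2.
have xr : `|x| <= r by rewrite /r; lra.
have r1 : r < 1 by rewrite /r; lra.
have r0 : 0 <= r by rewrite /r; have := normr_ge0 x; lra.
have e0 : 0 < e by rewrite /e; lra.
have q0 : 0 < 1 - x ^+ 2.
  by rewrite subr_gt0 -real_normK ?num_real// expr_lt1.
have qr : 0 < 1 - r ^+ 2 by rewrite subr_gt0 expr_lt1.
have n0 : 0 <= n%:R :> R by [].
have [L [L0 lip]] : exists L : R, 0 <= L /\ forall y z, `|y| <= r -> `|z| <= r ->
    y <= z -> u y - u z <= L * (z - y).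
  exists (n%:R / (1 - r ^+ 2)); split; first by rewrite divr_ge0// ltW.
  move=> y z yr zr yz; rewrite mulrAC ler_pdivlMr// mulrC.
  exact: (tail_lipschitz sigma0_unif).
pose C0 : R := (3 * n%:R + 4) * L.
have C00 : 0 <= C0 by rewrite /C0 mulr_ge0//; lra.
have main y : `|y - x| < e ->
    `|(1 - x ^+ 2) * (u x - u y) - n%:R * (y - x) * K x| <= C0 * (y - x) ^+ 2 /\
    `|K x - K y - x * (u x - u y)| <= 2 * L * (y - x) ^+ 2.
  move=> yx; have yr : `|y| <= r.
    rewrite -(subrK x y) (le_trans (ler_normD _ _))//.
    by move: yx; rewrite /e /r; lra.
  have [x1' y1'] : `|x| <= 1 /\ `|y| <= 1 by split; lra.
  have [xy|yltx] := leP x y.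
    have d0 : 0 <= y - x by lra.
    have D0 := tail_nonincreasing sigma0_unif xy.
    have D1 := lip _ _ xr yr xy.
    have k1 := tail_increment sigma0_unif x1' xy.
    have k2 := tmean_increment sigma0 xy.
    have dD : (y - x) * (u x - u y) <= L * (y - x) ^+ 2.
      by rewrite expr2 mulrCA ler_wpM2l.
    have Ld : 0 <= L * (y - x) ^+ 2 by rewrite mulr_ge0// sqr_ge0.
    split.
      apply: (le_trans k1); rewrite /C0 -!mulrA.
      apply: (@le_trans _ _ ((n%:R + 2) * (L * (y - x) ^+ 2))).
        by rewrite ler_wpM2l//; lra.
      by rewrite ler_wpM2r//; lra.
    by apply: (le_trans k2); rewrite -mulrA; lra.
  have yx' := ltW yltx.
  have d0 : 0 <= x - y by lra.
  have D0 := tail_nonincreasing sigma0_unif yx'.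
  have D0' : 0 <= u y - u x by lra.
  have D1 := lip _ _ yr xr yx'.
  have k1 := tail_increment sigma0_unif y1' yx'.
  have k2 := tmean_increment sigma0 yx'.
  have -> : (y - x) ^+ 2 = (x - y) ^+ 2 by ring.
  have dD : (x - y) * (u y - u x) <= L * (x - y) ^+ 2.
    by rewrite expr2 mulrCA ler_wpM2l.
  have Ld : 0 <= L * (x - y) ^+ 2 by rewrite mulr_ge0// sqr_ge0.
  have KK : `|K x - K y - x * (u x - u y)| <= 2 * ((x - y) * (u y - u x)).
    have -> : K x - K y - x * (u x - u y) =
      - (K y - K x - y * (u y - u x)) + (x - y) * (u y - u x) by ring.
    rewrite (le_trans (ler_normD _ _))// normrN [`|(x - y) * _|]ger0_norm ?mulr_ge0//.
    by move: k2; lra.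
  have K2 : `|K x - K y| <= 2 * (u y - u x).
    have -> : K x - K y = - (K y - K x - y * (u y - u x)) - y * (u y - u x) by ring.
    rewrite (le_trans (ler_normB _ _))// normrN normrM [`|u y - u x|]ger0_norm//.
    have : `|y| * (u y - u x) <= 1 * (u y - u x) by rewrite ler_wpM2r.
    have : (x - y) * (u y - u x) <= 1 * (u y - u x).
      rewrite ler_wpM2r//; move: yx; rewrite ltr_norml /e => /andP[].
      by have := normr_ge0 x; lra.
    by move: k2; lra.
  split; last by apply: (le_trans KK); rewrite -mulrA; lra.
  have -> : (1 - x ^+ 2) * (u x - u y) - n%:R * (y - x) * K x =
    - ((1 - y ^+ 2) * (u y - u x) - n%:R * (x - y) * K y)
    + ((x + y) * ((x - y) * (u y - u x)) + n%:R * ((x - y) * (K x - K y))) by ring.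
  rewrite (le_trans (ler_normD _ _))// normrN.
  have e1 : `|(x + y) * ((x - y) * (u y - u x))| <= 2 * ((x - y) * (u y - u x)).
    rewrite normrM [`|(x - y) * _|]ger0_norm ?mulr_ge0// ler_wpM2r ?mulr_ge0//.
    by rewrite (le_trans (ler_normD _ _))//; lra.
  have e2 : `|n%:R * ((x - y) * (K x - K y))| <= n%:R * ((x - y) * (2 * (u y - u x))).
    rewrite 2!normrM ger0_norm// ler_wpM2l// ger0_norm// ler_wpM2l//.
  have e3 := ler_normD ((x + y) * ((x - y) * (u y - u x))) (n%:R * ((x - y) * (K x - K y))).
  have e4 : (3 * n%:R + 4) * ((x - y) * (u y - u x)) <= C0 * (x - y) ^+ 2.
    by rewrite /C0 -mulrA ler_wpM2l//; lra.
  rewrite (le_trans _ e4)//.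
  rewrite (le_trans (lerD k1 (le_trans e3 (lerD e1 e2))))//.
  by rewrite le_eqVlt; apply/orP; left; apply/eqP; ring.
pose C := C0 / (1 - x ^+ 2).
have C_ge0 : 0 <= C by rewrite /C divr_ge0// ltW.
exists e, (C + 2 * L); split => // y /main[m1 m2].
have d2 : 0 <= (y - x) ^+ 2 := sqr_ge0 _.
have ueq : `|u y - u x - (- density x) * (y - x)| <= C * (y - x) ^+ 2.
  have -> : u y - u x - (- density x) * (y - x) = - (1 - x ^+ 2)^-1 *
    ((1 - x ^+ 2) * (u x - u y) - n%:R * (y - x) * K x).
    by rewrite /density; field; rewrite gt_eqF.
  rewrite normrM normrN normfV [`|1 - _|]gtr0_norm// ler_pdivrMl//.
  rewrite (le_trans m1)// le_eqVlt; apply/orP; left; apply/eqP.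
  by rewrite /C; field; rewrite gt_eqF.
split.
  by rewrite (le_trans ueq)// ler_wpM2r// lerDl mulr_ge0.
have -> : K y - K x - (- (x * density x)) * (y - x) =
  - (K x - K y - x * (u x - u y)) + x * (u y - u x - (- density x) * (y - x)) by ring.
rewrite (le_trans (ler_normD _ _))// normrN normrM.
have : `|x| * `|u y - u x - (- density x) * (y - x)| <= 1 * (C * (y - x) ^+ 2).
  by rewrite ler_pM// ltW.
by rewrite mulrDl; lra.
Qed.

Lemma tail_is_derive x : `|x| < 1 -> is_derive x 1 u (- density x).
Proof.
move=> /tail_tmean_expansion[e [C [e0 H]]].
by apply: (@is_derive_quadratic _ _ _ _ C e) => // y /H[].
Qed.

Lemma tmean_is_derive x : `|x| < 1 -> is_derive x 1 K (- (x * density x)).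
Proof.
move=> /tail_tmean_expansion[e [C [e0 H]]].
by apply: (@is_derive_quadratic _ _ _ _ C e) => // y /H[].
Qed.

End density.

(** * Monotonicity and bounds for the density and the tail *)

Section shape.
Context {R : realType} {n : nat}.
Variable sigma0 : probability (borelRV R n) R.
Hypothesis sigma0_unif : uniform_on_sphere sigma0.
Hypothesis n_gt1 : (1 < n)%N.
Implicit Types (r s t v w x y : R).
Local Notation law := (law sigma0).
Local Notation u := (tail sigma0).
Local Notation K := (tmean sigma0).
Local Notation density := (density sigma0).

Let n_gt0 : (0 < n)%N := ltnW n_gt1.

Let onem_sqr_gt0 x : `|x| < 1 -> 0 < 1 - x ^+ 2.
Proof. by move=> x1; rewrite subr_gt0 -real_normK ?num_real// expr_lt1. Qed.

(** Since K' = - n x K / (1 - x^2), dividing by a power of 1 - x^2 changes the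
    coefficient n into n - 2k. On [0, 1) the ratio is nonincreasing for k = 1,
    which says that the density is nonincreasing, and nondecreasing for k = n,
    which keeps K away from 0. *)
Lemma ratio_is_derive k x : `|x| < 1 ->
  is_derive x 1 (fun v => K v * ((1 - v ^+ 2) ^+ k)^-1)
    ((2 * k%:R - n%:R) * x * K x / (1 - x ^+ 2) ^+ k.+1).
Proof.
move=> x1; have q0 := onem_sqr_gt0 x1.
have dK := tmean_is_derive sigma0_unif x1.
have dq : is_derive x 1 (fun v => 1 - v ^+ 2) (- (2 * x)).
  have := is_deriveB (is_derive_cst (1 : R) x 1) (is_deriveX 2 (is_derive_id x 1)).
  move=> H; apply: (is_derive_eq H).
  by rewrite /GRing.scale /= sub0r mulr1 expr1.
have dqk : is_derive x 1 (fun v => (1 - v ^+ 2) ^+ k)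
    (k%:R * (1 - x ^+ 2) ^+ k.-1 * - (2 * x)).
  by have := is_deriveX k dq; rewrite exprfctE.
have qk0 : (1 - x ^+ 2) ^+ k != 0 by rewrite expf_neq0// gt_eqF.
have dV := @is_deriveV R (fun v => (1 - v ^+ 2) ^+ k) x _ 1 qk0 dqk.
have H := is_deriveM dK dV.
apply: (is_derive_eq H).
rewrite /GRing.scale /= /density.
have {}q0 : 1 - x ^+ 2 != 0 by rewrite gt_eqF.
clear dq dqk dV H; move: (1 - x ^+ 2) q0 qk0 => q q0.
case: k => [|k] /= qk0; first by rewrite expr0 expr1; field.
by rewrite [in q ^+ k.+2]exprS [q ^+ k.+1]exprS; field; rewrite expf_neq0.
Qed.

Lemma tmean_ge0 v : 0 <= v -> 0 <= K v.
Proof.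
move=> v0; apply: law_ge0 => //; first by solve_testfun1.
move=> t _; case: (ltP v t) => vt; rewrite ?mulr1 ?mulr0//.
exact: le_trans v0 (ltW vt).
Qed.

(** By symmetry of the law both sides are the same integral, except that the strict
    inequality on one side becomes a weak one on the other. *)
Lemma tmean_opp v : 0 <= v -> K v <= K (- v).
Proof.
move=> v0; have id0 := law_id sigma0_unif n_gt0.
have -> : K v = K v - law (fun t => t) by rewrite id0 subr0.
rewrite /tmean -(law_even sigma0_unif n_gt0 (p := fun t => t * (- v < t)%R%:R));
  last by solve_testfun1.
rewrite -lawN; last by solve_testfun1.
rewrite -lawD; try by solve_testfun1.
apply: law_le => //.
- by apply: testfun1D; solve_testfun1.
- by apply: (testfun1_opp (p := fun t => t * (- v < t)%R%:R)); solve_testfun1.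
move=> t _; rewrite ltrN2; case: (ltP v t) => vt; case: (ltP t v) => tv;
  rewrite ?mulr1 ?mulr0; lra.
Qed.

(** Otherwise t would vanish almost surely; but its second moment is positive and
    t^2 <= |t|, whose expectation is twice K(0). *)
Lemma tmean0_gt0 : 0 < K 0.
Proof.
have : 0 < law (fun t => t ^+ 2).
  by rewrite law_sqr// invr_gt0 ltr0n.
suff : law (fun t => t ^+ 2) <= 2 * K 0 by lra.
have -> : 2 * K 0 = 2 * K 0 - law (fun t => t) by rewrite law_id// subr0.
rewrite /tmean -lawZ -?lawN -?lawD; try by solve_testfun1.
apply: law_le => //; try by solve_testfun1.
move=> t; rewrite ler_norml => /andP[t1 t2].
by case: ltP => t0; rewrite ?mulr1 ?mulr0; nra.
Qed.

Let ratio_MVT k x y : 0 <= x -> x < y -> y < 1 ->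
  exists2 c, x < c < y & K y * ((1 - y ^+ 2) ^+ k)^-1 - K x * ((1 - x ^+ 2) ^+ k)^-1 =
    ((2 * k%:R - n%:R) * c * K c / (1 - c ^+ 2) ^+ k.+1) * (y - x).
Proof.
move=> x0 xy y1; apply: (@MVT_derive R (fun v => K v * ((1 - v ^+ 2) ^+ k)^-1)
  (fun c => (2 * k%:R - n%:R) * c * K c / (1 - c ^+ 2) ^+ k.+1)) => // z /andP[xz zy].
by apply: ratio_is_derive; rewrite ger0_norm; lra.
Qed.

Lemma tmean_lower v : 0 <= v < 1 -> K 0 * (1 - v ^+ 2) ^+ n <= K v.
Proof.
move=> /andP[]; rewrite le_eqVlt => /predU1P[<- _|v0 v1].
  by rewrite expr0n subr0 expr1n mulr1.
have q0 : 0 < (1 - v ^+ 2) ^+ n.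
  by rewrite exprn_gt0// onem_sqr_gt0// ger0_norm// ltW.
have [c /andP[c0 cv]] := ratio_MVT n (lexx 0) v0 v1.
rewrite expr0n subr0 expr1n invr1 mulr1 => H.
rewrite -ler_pdivlMr// -subr_ge0 H subr0 mulr_ge0//; last exact: ltW.
rewrite divr_ge0//.
  rewrite mulr_ge0// ?tmean_ge0// ?(ltW c0)// mulr_ge0// ?(ltW c0)//.
  by have : 0 <= n%:R :> R by []; lra.
by rewrite exprn_ge0// ltW// onem_sqr_gt0// ger0_norm; lra.
Qed.

Lemma tmean_gt0 v : `|v| < 1 -> 0 < K v.
Proof.
have pos w : 0 <= w < 1 -> 0 < K w.
  move=> /[dup] w01 /tmean_lower; apply: lt_le_trans.
  case/andP: w01 => w0 w1; rewrite mulr_gt0 ?tmean0_gt0// exprn_gt0//.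
  by rewrite onem_sqr_gt0// ger0_norm.
have [v0 v1|v0 v1] := leP 0 v.
  by apply: pos; rewrite v0 -(ger0_norm v0).
rewrite -(opprK v); apply: lt_le_trans (tmean_opp _); last by lra.
by apply: pos; rewrite -(ltr0_norm v0) v1 normr_ge0.
Qed.

Lemma density_gt0 v : `|v| < 1 -> 0 < density v.
Proof.
move=> v1; rewrite /density divr_gt0 ?onem_sqr_gt0// mulr_gt0 ?tmean_gt0//.
by rewrite ltr0n.
Qed.

(** The density is n times the ratio with k = 1, and 2 - n <= 0. *)
Lemma density_nonincreasing x y : 0 <= x -> x < y -> y < 1 ->
  density y <= density x.
Proof.
move=> x0 xy y1; have [c /andP[xc cy]] := ratio_MVT 1 x0 xy y1.
rewrite !expr1 => H; rewrite /density -!mulrA ler_wpM2l// -subr_le0 H.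
rewrite mulr_le0_ge0//; last lra.
have c1 : `|c| < 1 by rewrite ger0_norm; lra.
rewrite -mulrA mulr_le0_ge0//; last first.
  by rewrite divr_ge0// ?exprn_ge0// ltW// ?tmean_gt0// onem_sqr_gt0.
rewrite mulr_le0_ge0//; last lra.
have n2 : 2 <= n%:R :> R by rewrite ler_nat.
by lra.
Qed.

Lemma tail_ge0 v : 0 <= u v.
Proof. by apply: law_ge0 => //; solve_testfun1. Qed.

Lemma tail_le1 v : u v <= 1.
Proof.
rewrite -[leRHS](law_cst sigma0_unif 1); apply: law_le => //; try by solve_testfun1.
by move=> t _; case: (_ < _).
Qed.

Lemma tail_decreasing x y : -1 < x -> x < y -> y < 1 -> u y < u x.
Proof.
move=> x1 xy y1.
have [c /andP[xc cy] H] : exists2 c, x < c < y & u y - u x = - density c * (y - x).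
  apply: MVT_derive => // z /andP[xz zy]; apply: tail_is_derive => //.
  by rewrite ltr_norml; lra.
have c1 : `|c| < 1 by rewrite ltr_norml; lra.
have := density_gt0 c1 => d0.
by rewrite -subr_lt0 H mulNr oppr_lt0 mulr_gt0// subr_gt0.
Qed.

Lemma tail_lt1 v : `|v| < 1 -> u v < 1.
Proof.
rewrite ltr_norml => /andP[v1 v2].
apply: (lt_le_trans (@tail_decreasing ((v - 1) / 2) v _ _ _)); [lra..|].
exact: tail_le1.
Qed.

(** The events t > 0 and t < 0 are disjoint and equally likely. *)
Lemma tail0_le : u 0 <= 1 / 2.
Proof.
suff : u 0 + u 0 <= 1 by lra.
rewrite -{2}[u 0](law_even sigma0_unif n_gt0); last by solve_testfun1.
rewrite /tail -lawD; try by solve_testfun1.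
  rewrite -[leRHS](law_cst sigma0_unif 1); apply: law_le => //.
  - by apply: testfun1D; [|apply: (testfun1_opp (p := fun t => (0 < t)%R%:R))]; solve_testfun1.
  - by solve_testfun1.
  move=> t _; rewrite oppr_gt0; case: ltP => t0; case: ltP => t0' //=; lra.
by apply: (testfun1_opp (p := fun t => (0 < t)%R%:R)); solve_testfun1.
Qed.

Lemma tmean_le_tail v : K v <= u v.
Proof.
apply: law_le; try by solve_testfun1.
by move=> t; rewrite ler_norml => /andP[_ t1]; case: ltP => _; rewrite ?mulr1 ?mulr0.
Qed.

Lemma tmean_le_head v : K v <= 1 - u v.
Proof.
have -> : K v = K v - law (fun t => t) by rewrite law_id// subr0.
have -> : 1 - u v = law (fun=> 1) - u v by rewrite law_cst.
rewrite /tmean /tail -!lawN -?lawD; try by solve_testfun1.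
apply: law_le; try by solve_testfun1.
by move=> t; rewrite ler_norml => /andP[t1 _]; case: ltP => _ /=;
  rewrite ?mulr1 ?mulr0; lra.
Qed.

(** Excludes an atom at the pole: the density bound forces K(v) to vanish at 1, and
    K(v) dominates v times the tail. *)
Lemma tail_near1 v : 1 / 2 <= v < 1 -> u v <= 4 * K 0 * (1 - v).
Proof.
move=> /andP[v2 v1]; have v0 : 0 < v by lra.
have k1 : v * u v <= K v.
  rewrite /tail -lawZ; last by solve_testfun1.
  apply: law_le; try by solve_testfun1.
  by move=> t _; case: ltP => vt; rewrite ?mulr1 ?mulr0// ltW.
have vn : `|v| < 1 by rewrite ger0_norm; lra.
have := density_nonincreasing (lexx 0) v0 v1.
rewrite /density expr0n subr0 divr1 ler_pdivrMr ?onem_sqr_gt0//.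
rewrite -[n%:R * K 0 * _]mulrA ler_pM2l ?ltr0n// => k2.
have k0 := tmean0_gt0.
have k3 : K 0 * (1 - v ^+ 2) <= K 0 * (2 * (1 - v)).
  by rewrite ler_pM2l//; nra.
have k4 : 1 / 2 * u v <= v * u v by rewrite ler_wpM2r ?tail_ge0.
by lra.
Qed.

(** The tail is convex on [0, 1) because the density is nonincreasing there; it is at
    most 1/2 at 0 and tends to 0 at 1, so it lies below the chord joining
    (0, 1/2) to (1, 0). Slopes are compared on [0, s] and on [s, w] with w close
    to 1. *)
Lemma tail_le_chord s : 0 < s < 1 -> u s <= (1 - s) / 2.
Proof.
move=> /andP[s0 s1].
have mvt x y : 0 <= x -> x < y -> y < 1 ->
    exists2 c, x < c < y & u x - u y = density c * (y - x).
  move=> x0 xy y1.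
  have [c cxy H] : exists2 c, x < c < y & u y - u x = - density c * (y - x).
    apply: MVT_derive => // z /andP[xz zy]; apply: tail_is_derive => //.
    by rewrite ltr_norml; lra.
  by exists c => //; rewrite -opprB H mulNr opprK.
have [c /andP[c0 cs] Hc] := mvt _ _ (lexx 0) s0 s1.
suff H : u s * s <= (1 / 2 - u s) * (1 - s) by nra.
apply: (@le_of_eps _ (2 * K 0 * s * (1 - s))) => e /andP[e0 e1].
(* close enough to 1 for the tail at w to be negligible, but still beyond s
   and 1/2 *)
pose w := 1 - e * (1 - s) / 2.
have es0 : 0 < e * (1 - s) by rewrite mulr_gt0//; lra.
have es1 : e * (1 - s) <= 1 - s by rewrite ler_piMl//; lra.
have [d /andP[sd dw] Hd] := mvt s w (ltW s0) ltac:(rewrite /w; lra) ltac:(rewrite /w; lra).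
have dc := @density_nonincreasing c d (ltW c0) ltac:(lra) ltac:(rewrite /w in dw; lra).
have uw := @tail_near1 w ltac:(apply/andP; rewrite /w; split; lra).
have ws : 0 <= w - s by lra.
have h1 : s * (u s - u w) <= (u 0 - u s) * (w - s).
  rewrite Hd Hc subr0.
  have -> : s * (density d * (w - s)) = s * (w - s) * density d by ring.
  have -> : density c * s * (w - s) = s * (w - s) * density c by ring.
  by rewrite ler_wpM2l// mulr_ge0// ltW.
have us0 : 0 <= u 0 - u s.
  by rewrite Hc mulr_ge0//; [apply/ltW/density_gt0; rewrite ger0_norm|]; lra.
have h2 : (u 0 - u s) * (w - s) <= (1 / 2 - u s) * (1 - s).
  by rewrite ler_pM//; [have := tail0_le|rewrite /w]; lra.
have h3 : s * u w <= 2 * K 0 * s * (1 - s) * e.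
  have -> : 2 * K 0 * s * (1 - s) * e = s * (4 * K 0 * (1 - w)) by rewrite /w; field.
  by rewrite ler_pM2l.
lra.
Qed.

End shape.

(** * The gain function *)

Section gain.
Context {R : realType} {n : nat}.
Variable sigma0 : probability (borelRV R n) R.
Hypothesis sigma0_unif : uniform_on_sphere sigma0.
Hypothesis n_gt1 : (1 < n)%N.
Implicit Types (r s t v w x y : R).
Local Notation law := (law sigma0).
Local Notation u := (tail sigma0).
Local Notation K := (tmean sigma0).
Local Notation density := (density sigma0).

Let n_gt0 : (0 < n)%N := ltnW n_gt1.

(** With N = E[1 - t; t <= s], the gain N^2 / (1 - u^2) is the amount by which
    cutting at s = 1 - a lowers the total second moment 2; N equals 1 - u + K
    because t has mean zero. *)
Definition gain s : R :=
  (1 - tail sigma0 s + tmean sigma0 s) ^+ 2 / (1 - tail sigma0 s ^+ 2).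

Lemma tail1 : u 1 = 0.
Proof.
rewrite -(law_cst sigma0_unif 0); apply: eq_law => t.
by rewrite ler_norml => /andP[_ t1]; rewrite ltNge t1.
Qed.

Lemma tmean1 : K 1 = 0.
Proof.
rewrite -(law_cst sigma0_unif 0); apply: eq_law => t.
by rewrite ler_norml => /andP[_ t1]; rewrite ltNge t1 mulr0.
Qed.

Lemma gain1 : gain 1 = 1.
Proof. by rewrite /gain tail1 tmean1 expr0n subr0 addr0 expr1n divr1. Qed.

(** By symmetry this is the mass of the opposite pole, which every tail close to 1
    dominates. *)
Lemma law_pole : law (fun t => (t <= -1)%R%:R) = 0.
Proof.
have aN : testfun1 (fun t : R => (- t <= -1)%R%:R).
  by apply: (testfun1_opp (p := fun t => (t <= -1)%R%:R)); solve_testfun1.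
rewrite -(law_even sigma0_unif n_gt0); last by solve_testfun1.
apply/eqP; rewrite eq_le; apply/andP; split; last first.
  by apply: law_ge0 => // t _; case: (_ <= _).
apply: (@le_of_eps _ (1 / 4)) => e /andP[e0 e1].
have e2 : 0 < 1 - e / 2 < 1 by apply/andP; split; lra.
rewrite add0r; have := tail_le_chord sigma0_unif n_gt1 e2.
suff : law (fun t => (- t <= -1)%R%:R) <= u (1 - e / 2) by lra.
apply: law_le => //; first by solve_testfun1.
move=> t _; case: (leP (- t) (-1)) => t1; last by case: (_ < _).
by rewrite (_ : 1 - e / 2 < t) //; lra.
Qed.

(** This is the sign of the derivative of the gain. For s <= 0 it follows from
    K <= 1 - u and 1 - s >= 1; for s > 0 from the chord bound u <= (1 - s) / 2,
    which also gives u <= 1/2, together with K <= u. *)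
Lemma gain_criterion s : `|s| < 1 ->
  u s * (1 - u s + K s) < (1 - s) * (1 - u s ^+ 2).
Proof.
move=> s1; have u0 := tail_ge0 sigma0_unif s.
have u1 := tail_lt1 sigma0_unif n_gt1 s1.
have Ku := tmean_le_tail sigma0 s.
have Kh := tmean_le_head sigma0_unif n_gt1 s.
have uK : u s * (1 - u s + K s) <= u s by rewrite ler_piMr//; lra.
move: s1; rewrite ltr_norml => /andP[sN1 s1].
have [s0|s0] := ltP 0 s.
  have us := tail_le_chord sigma0_unif n_gt1 (s := s) ltac:(lra).
  have u2 : u s ^+ 2 <= 1 / 4 by nra.
  have : (1 - s) * (3 / 4) <= (1 - s) * (1 - u s ^+ 2) by rewrite ler_pM2l; lra.
  by lra.
have : u s * (1 - u s + K s) <= u s * (2 * (1 - u s)).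
  by rewrite ler_wpM2l//; lra.
have : 1 * (1 - u s ^+ 2) <= (1 - s) * (1 - u s ^+ 2).
  by rewrite ler_wpM2r//; [nra|lra].
have : 0 < (1 - u s) * (1 - u s) by rewrite mulr_gt0 ?subr_gt0.
by nra.
Qed.

Let dgain s : R := 2 * (1 - u s + K s) * density s *
  ((1 - s) * (1 - u s ^+ 2) - u s * (1 - u s + K s)) / (1 - u s ^+ 2) ^+ 2.

Let den_gt0 s : `|s| < 1 -> 0 < 1 - u s ^+ 2.
Proof.
move=> s1; rewrite subr_gt0 expr_lt1// ?tail_ge0//.
exact: tail_lt1.
Qed.

Let num_gt0 s : `|s| < 1 -> 0 < 1 - u s + K s.
Proof.
move=> s1; have := tail_lt1 sigma0_unif n_gt1 s1.
by have := tmean_gt0 sigma0_unif n_gt1 s1; lra.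
Qed.

Let gain_is_derive s : `|s| < 1 -> is_derive s 1 gain (dgain s).
Proof.
move=> s1; have q0 := den_gt0 s1.
have dK := tmean_is_derive sigma0_unif s1.
have du := tail_is_derive sigma0_unif s1.
have dnum : is_derive s 1 (fun s => (1 - u s + K s) ^+ 2)
    (2 * (1 - u s + K s) * ((1 - s) * density s)).
  have := is_deriveX 2 (is_deriveD (is_deriveB (is_derive_cst (1 : R) s 1) du) dK).
  move=> H; apply: (is_derive_eq H).
  by rewrite /GRing.scale /= expr1; congr (_ * _); ring.
have dden : is_derive s 1 (fun s => 1 - u s ^+ 2) (2 * u s * density s).
  have := is_deriveB (is_derive_cst (1 : R) s 1) (is_deriveX 2 du).
  move=> H; apply: (is_derive_eq H).
  by rewrite /GRing.scale /= expr1; ring.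
have dV := @is_deriveV R (fun s => 1 - u s ^+ 2) s _ 1 (lt0r_neq0 q0) dden.
apply: (is_derive_eq (is_deriveM dnum dV)).
rewrite /GRing.scale /= /dgain.
by field; rewrite gt_eqF.
Qed.

Lemma gain_derive_gt0 s : `|s| < 1 -> exists2 d, 0 < d & is_derive s 1 gain d.
Proof.
move=> s1; exists (dgain s); last exact: gain_is_derive.
rewrite /dgain divr_gt0 ?exprn_gt0 ?den_gt0// mulr_gt0//.
  apply: mulr_gt0; last exact: density_gt0.
  by apply: mulr_gt0; [|exact: num_gt0].
by rewrite subr_gt0 gain_criterion.
Qed.

Lemma gain_increasing x y : -1 < x -> x < y -> y < 1 -> gain x < gain y.
Proof.
move=> x1 xy y1.
have [c /andP[xc cy] H] : exists2 c, x < c < y & gain y - gain x = dgain c * (y - x).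
  by apply: MVT_derive => // z /andP[xz zy]; apply: gain_is_derive; rewrite ltr_norml; lra.
have c1 : `|c| < 1 by rewrite ltr_norml; lra.
rewrite -subr_gt0 H mulr_gt0 ?subr_gt0//.
have [d d0 dd] := gain_derive_gt0 c1.
have := @derive_val _ _ _ _ _ _ _ dd.
by have -> := @derive_val _ _ _ _ _ _ _ (gain_is_derive c1) => ->.
Qed.

(** The gain increases strictly, and its values near 1 are at most 1 / (1 - u^2)
    with u tending to 0. *)
Lemma gain_lt1 s : `|s| < 1 -> gain s < 1.
Proof.
rewrite ltr_norml => /andP[sN1 s1].
pose x := (1 + s) / 2.
have gx : gain s < gain x by apply: gain_increasing; rewrite /x; lra.
apply: (lt_le_trans gx); have x1 : x < 1 by rewrite /x; lra.
have x0 : 0 < x by rewrite /x; lra.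
have gx0 : 0 <= gain x.
  by rewrite /gain divr_ge0 ?sqr_ge0// ltW// den_gt0// ger0_norm// ltW.
apply: (@le_of_eps _ (gain x)) => e /andP[e0 e1].
pose y := 1 - e * (1 - x) / 2.
have ex0 : 0 < e * (1 - x) by rewrite mulr_gt0//; lra.
have ex1 : e * (1 - x) <= 1 - x by rewrite ler_piMl//; lra.
have ex2 : e * (1 - x) <= e by rewrite ler_piMr//; lra.
have xy : x < y by rewrite /y; lra.
have y1 : y < 1 by rewrite /y; lra.
have yn : `|y| < 1 by rewrite ger0_norm; lra.
have uy := tail_le_chord sigma0_unif n_gt1 (s := y) ltac:(lra).
have u0 := tail_ge0 sigma0_unif y.
have Ku := tmean_le_tail sigma0 y.
have u2 : u y ^+ 2 <= e.
  by rewrite expr2; apply: (@le_trans _ _ (u y)); [rewrite ler_piMr//|]; rewrite /y in uy *; lra.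
have gy1 : gain y * (1 - u y ^+ 2) <= 1.
  rewrite /gain divfK ?gt_eqF ?den_gt0//.
  by rewrite expr_le1//; have := num_gt0 yn; lra.
have gxy := gain_increasing (ltac:(lra) : -1 < x) xy y1.
have h1 : gain x * (1 - u y ^+ 2) <= gain y * (1 - u y ^+ 2).
  by rewrite ler_wpM2r// ltW// den_gt0.
have h2 : gain x * u y ^+ 2 <= gain x * e by rewrite ler_wpM2l.
by lra.
Qed.

End gain.

(** * The cost of a part cut out by the first coordinate *)

Section cost.
Context {R : realType} {n : nat}.
Variable sigma0 : probability (borelRV R n) R.
Hypothesis sigma0_unif : uniform_on_sphere sigma0.
Hypothesis n_gt1 : (1 < n)%N.
Local Notation law := (law sigma0).
Local Notation avg := (avg sigma0).

Section region.
Variable b : R -> bool.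
Hypothesis mb : measurable_fun [set: R] b.

Definition slab : set (borelRV R n) :=
  [set x | supp x /\ b ((x : 'rV[R]_n.+1) ord0 ord0)].

Lemma measurable_slab : measurable slab.
Proof.
apply: measurableI; first by apply: measurableU; exact: measurable_sphere.
rewrite -[X in measurable X]setTI.
exact: (measurableT_comp mb (measurable_coord ord0)).
Qed.

Lemma testfun1_shift (a : R) : testfun1 (fun t => (b (t + a))%:R).
Proof.
apply: testfun1_bool; apply: (measurableT_comp mb).
by apply: measurable_funD; [exact: measurable_id|exact: measurable_cst].
Qed.

(** The complement of the sphere is a null set, so the slab may be replaced by its
    trace on the sphere, where membership in the support is automatic. *)
Lemma integral_sigma (a : R) (g : 'rV[R]_n.+1 -> R) :
  (forall x, @sphere R n a x -> supp x) ->
  measurable_fun [set: borelRV R n] g -> (forall x, 0 <= g x) ->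
  testfun (fun x => g (x + a *: e1 R n)) ->
  (\int[sigma sigma0 a]_(x in slab) (g x)%:E =
   (avg (fun x => g (x + a *: e1 R n) * (b (x ord0 ord0 + a))%:R))%:E)%E.
Proof.
move=> sa mg g0 ng.
have mt := @measurable_translate R n a.
have mpre : measurable (translate a @^-1` slab).
  by rewrite -[X in measurable X]setTI; apply: mt => //; exact: measurable_slab.
have sS (x : 'rV[R]_n.+1) : sphere 0 x -> supp (x + a *: e1 R n : borelRV R n).
  by move=> Sx; apply: sa; move: Sx; rewrite /sphere /= scale0r subr0 addrK.
rewrite (@ge0_integral_pushforward _ _ (borelRV R n) (borelRV R n) R (translate a) mt
   sigma0 slab (fun x => (g x)%:E)); last 3 first.
- exact: measurable_slab.
- by apply/measurable_EFinP; apply: measurable_funS mg.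
- by move=> x _; rewrite lee_fin.
have nf : testfun (fun x => g (x + a *: e1 R n) * (b (x ord0 ord0 + a))%:R).
  by apply: testfunM => //; exact: (testfun_testfun1 (testfun1_shift a)).
rewrite /avg /Rintegral fineK; last first.
  exact: (integrable_fin_num (measurable_sphere 0) (testfun_integrable sigma0 nf)).
have mtg : measurable_fun (translate a @^-1` slab)
    ((fun x : borelRV R n => (g x)%:E) \o translate a).
  apply: measurable_funTS; apply: measurableT_comp mt.
  exact/measurable_EFinP.
have S0 : sigma0 (~` @sphere R n 0) = 0%E.
  rewrite probability_setC; last exact: measurable_sphere.
  by rewrite sigma0_unif.1 subee.
rewrite (ge0_negligible_integral (N := ~` @sphere R n 0) _ mpre mtg _ S0);
  [|exact: (measurableC (@measurable_sphere R n 0))|by move=> x _; rewrite lee_fin].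
have -> : (translate a @^-1` slab) `\` ~` @sphere R n 0 =
    @sphere R n 0 `&` [set x : borelRV R n | b ((x : 'rV[R]_n.+1) ord0 ord0 + a)].
  have xa (x : 'rV[R]_n.+1) :
      (x + a *: e1 R n) ord0 ord0 = x ord0 ord0 + a.
    by rewrite /e1 !mxE !eqxx /= mulr1.
  rewrite setDE setCK; apply/seteqP; split => x /=.
    by rewrite /slab /translate /= xa => -[[_ bx] Sx].
  by rewrite /slab /translate /= xa => -[Sx bx]; do !split => //; exact: sS.
rewrite integral_mkcondr; apply: eq_integral => x _.
rewrite patchE /= /translate; case: ifPn => [/set_mem /= ->|].
  by rewrite mulr1.
by rewrite notin_setE /= => /negP/negbTE ->; rewrite mulr0.
Qed.

Lemma integral_rho (g : 'rV[R]_n.+1 -> R) :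
  measurable_fun [set: borelRV R n] g -> (forall x, 0 <= g x) ->
  (forall a : R, testfun (fun x => g (x + a *: e1 R n))) ->
  (\int[rho sigma0]_(x in slab) (g x)%:E =
   (1 / 2 * (avg (fun x => g (x + -1 *: e1 R n) * (b (x ord0 ord0 - 1))%:R) +
    avg (fun x => g (x + 1 *: e1 R n) * (b (x ord0 ord0 + 1))%:R)))%:E)%E.
Proof.
move=> mg g0 ng.
have mE D : measurable_fun D (fun x : borelRV R n => (g x)%:E).
  by apply: measurable_funTS; exact/measurable_EFinP.
have gE0 (x : borelRV R n) : slab x -> (0 <= (g x)%:E)%E by rewrite lee_fin.
rewrite /rho ge0_integral_mscale//; last exact: measurable_slab.
rewrite ge0_integral_measure_add//; last exact: measurable_slab.
rewrite (integral_sigma (a := -1))//; last by move=> x Sx; left.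
rewrite (integral_sigma (a := 1))//; last by move=> x Sx; right.
by rewrite -EFinD -EFinM div1r.
Qed.

Let p (a t : R) : R := (b (t + a))%:R.

Let ap a : testfun1 (p a). Proof. exact: testfun1_shift. Qed.

Lemma coord_shift (a : R) (x : 'rV[R]_n.+1) i :
  (x + a *: e1 R n) ord0 i = x ord0 i + a * (i == ord0)%:R.
Proof. by rewrite /e1 !mxE eqxx. Qed.

Lemma testfun_shifted_cost (a : R) (c : 'rV[R]_n.+1) :
  testfun (fun x => enorm (x + a *: e1 R n - c) ^+ 2).
Proof.
rewrite (_ : (fun x => _) = fun x : 'rV[R]_n.+1 =>
    \sum_i (x ord0 i + (a * (i == ord0)%:R - c ord0 i)) ^+ 2).
  apply: testfun_sum => i; apply: testfunX.
  by apply: testfunD; [exact: testfun_coord|exact: testfun_cst].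
apply/funext => x; rewrite enorm_sqrB; apply: eq_bigr => i _.
by rewrite coord_shift addrA.
Qed.

(** On the sphere |x + a e_1|^2 = 2 + 2 a x_0 because a^2 = 1, and the terms linear
    in the other coordinates average to zero. *)
Lemma avg_shifted_cost (a : R) (c : 'rV[R]_n.+1) : a ^+ 2 = 1 ->
  avg (fun x => enorm (x + a *: e1 R n - c) ^+ 2 * (b (x ord0 ord0 + a))%:R) =
  2 * law (fun t => (1 + a * t) * p a t)
  - 2 * c ord0 ord0 * law (fun t => (t + a) * p a t)
  + (\sum_i c ord0 i ^+ 2) * law (p a).
Proof.
move=> a2.
pose C : R := \sum_i c ord0 i ^+ 2.
have a0 : testfun1 (fun t => (2 * (1 + a * t) + (- (2 * c ord0 ord0)) * (t + a) + C) * p a t).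
  by apply: testfun1M => //; solve_testfun1.
have nj (i : 'I_n.+1) : testfun (fun x : 'rV[R]_n.+1 =>
    (- (2 * c ord0 i)) * (p a (x ord0 ord0) * x ord0 i)).
  apply: testfunM; first exact: testfun_cst.
  by apply: testfunM; [exact: testfun_testfun1|exact: testfun_coord].
transitivity (avg (fun x =>
    (2 * (1 + a * x ord0 ord0) + (- (2 * c ord0 ord0)) * (x ord0 ord0 + a) + C)
      * p a (x ord0 ord0) +
    \sum_(i | i != ord0) (- (2 * c ord0 i)) * (p a (x ord0 ord0) * x ord0 i))).
  apply: eq_avg => x /sphere0E x1; rewrite enorm_sqrB -/(p a (x ord0 ord0)).
  have sum0 (F : 'I_n.+1 -> R) : \sum_i F i = F ord0 + \sum_(i | i != ord0) F i.
    by rewrite (bigD1 ord0).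
  rewrite sum0 in x1; rewrite /C !sum0 coord_shift eqxx /= mulr1.
  rewrite (eq_bigr (fun i => x ord0 i ^+ 2 + c ord0 i ^+ 2 +
    (- (2 * c ord0 i)) * x ord0 i)); last first.
    by move=> i /negPf i0; rewrite coord_shift i0 mulr0 addr0; ring.
  rewrite !big_split /=.
  rewrite [X in _ = _ + X](eq_bigr (fun i => ((- (2 * c ord0 i)) * x ord0 i)
     * p a (x ord0 ord0))); last by move=> i _; ring.
  have {}x1 : \sum_(i < n.+1 | i != ord0) x ord0 i ^+ 2 = 1 - x ord0 ord0 ^+ 2.
    by rewrite -x1 addrAC subrr add0r.
  rewrite -mulr_suml x1.
  have -> : (x ord0 ord0 + a - c ord0 ord0) ^+ 2 =
    x ord0 ord0 ^+ 2 + 2 * a * x ord0 ord0 + a ^+ 2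
    - 2 * c ord0 ord0 * (x ord0 ord0 + a) + c ord0 ord0 ^+ 2 by ring.
  by rewrite a2; ring.
rewrite avgD; [|exact: (testfun_testfun1 a0)|by apply: testfun_sum => i; exact: nj].
rewrite (avg_sum sigma0 _ _ nj) big1 ?addr0; last first.
  move=> i i0; rewrite avgZ; last first.
    by apply: testfunM; [exact: testfun_testfun1|exact: testfun_coord].
  by rewrite avg_coord_odd ?mulr0//; exact: (testfun_testfun1 (ap a)).
rewrite -/(law (fun t => (2 * (1 + a * t) + (- (2 * c ord0 ord0)) * (t + a) + C) * p a t)).
rewrite -[X in _ = _ + X + _]mulNr -law_lin3//; try by solve_testfun1.
by apply: eq_law => t _; rewrite /C; ring.
Qed.

(** Both spheres contribute: on the one centred at a e_1 the first coordinate of the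
    point is t + a. *)
Definition slab_mass : R := (law (p (-1)) + law (p 1)) / 2.
Definition slab_moment : R :=
  (law (fun t => (t - 1) * p (-1) t) + law (fun t => (t + 1) * p 1 t)) / 2.
Definition slab_energy : R :=
  law (fun t => (1 - t) * p (-1) t) + law (fun t => (1 + t) * p 1 t).

(** The cost is a quadratic polynomial in the centre; completing the square shows
    that the minimiser is the barycentre, which lies on the axis. *)
Lemma cluster_cost_slab : 0 < slab_mass ->
  cluster_cost (rho sigma0) slab =
  (slab_energy - slab_moment ^+ 2 / slab_mass)%:E.
Proof.
move=> m0.
have costE (c : 'rV[R]_n.+1) :
    (\int[rho sigma0]_(x in slab) (enorm ((x : 'rV[R]_n.+1) - c) ^+ 2)%:E)%E =
    (slab_energy - 2 * c ord0 ord0 * slab_moment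
      + (\sum_i c ord0 i ^+ 2) * slab_mass)%:E.
  rewrite (integral_rho (g := fun x => enorm (x - c) ^+ 2)); last 3 first.
  - exact: measurable_enorm2B.
  - by move=> x; exact: sqr_ge0.
  - by move=> a; exact: testfun_shifted_cost.
  congr EFin; rewrite !avg_shifted_cost ?expr1n ?sqrrN ?expr1n//.
  rewrite /slab_energy /slab_moment /slab_mass.
  have -> : law (fun t => (1 + -1 * t) * p (-1) t) = law (fun t => (1 - t) * p (-1) t).
    by apply: eq_law => t _; ring.
  have -> : law (fun t => (1 + 1 * t) * p 1 t) = law (fun t => (1 + t) * p 1 t).
    by apply: eq_law => t _; ring.
  by field.
apply/eqP; rewrite eq_le; apply/andP; split; last first.
  apply: le_ereal_inf_tmp => _ [c _ <-]; rewrite costE lee_fin.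
  rewrite (bigD1 ord0)//=.
  set X := \sum_(i | _) _; have X0 : 0 <= X.
    by apply: sumr_ge0 => i _; exact: sqr_ge0.
  rewrite -subr_ge0.
  have -> : slab_energy - 2 * c ord0 ord0 * slab_moment
      + (c ord0 ord0 ^+ 2 + X) * slab_mass
      - (slab_energy - slab_moment ^+ 2 / slab_mass) =
    (c ord0 ord0 * slab_mass - slab_moment) ^+ 2 / slab_mass + X * slab_mass.
    by field; rewrite gt_eqF.
  apply: addr_ge0; last by rewrite mulr_ge0// ltW.
  by rewrite divr_ge0 ?sqr_ge0// ltW.
apply: ereal_inf_lbound; exists ((slab_moment / slab_mass) *: e1 R n) => //.
rewrite costE; congr EFin.
have cE i : ((slab_moment / slab_mass) *: e1 R n) ord0 i =
    slab_moment / slab_mass * (i == ord0)%:R by rewrite /e1 !mxE eqxx.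
rewrite (bigD1 ord0)//= big1 ?addr0; last first.
  by move=> i /negPf i0; rewrite cE i0 mulr0 expr0n.
by rewrite cE eqxx /= mulr1; field; rewrite gt_eqF.
Qed.

End region.
End cost.

(** * The error of the cut and the minimum *)

Section error.
Context {R : realType} {n : nat}.
Variable sigma0 : probability (borelRV R n) R.
Hypothesis sigma0_unif : uniform_on_sphere sigma0.
Hypothesis n_gt1 : (1 < n)%N.
Local Notation law := (law sigma0).
Local Notation u := (tail sigma0).
Local Notation K := (tmean sigma0).

Let n_gt0 : (0 < n)%N := ltnW n_gt1.

(** For 0 <= a only the sphere centred at - e_1 meets the half-space x_0 <= - a,
    except that for a = 0 the two spheres touch at the origin, a null set. The
    first part then has mass (1 - u) / 2, moment - N / 2 and energy N, the second
    one (1 + u) / 2, N / 2 and 2 - N, where N = 1 - u + K, and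
    N^2 / (2 (1 - u)) + N^2 / (2 (1 + u)) = N^2 / (1 - u^2). *)
Lemma mse_cutE (a : R) : 0 <= a < 2 ->
  mse_cut sigma0 a = 2 - gain sigma0 (1 - a).
Proof.
move=> /andP[a0 a2].
pose b1 t : bool := t <= - a; pose b2 t : bool := - a < t.
have mb1 : measurable_fun [set: R] b1.
  by apply: measurable_fun_ler; [exact: measurable_id|exact: measurable_cst].
have mb2 : measurable_fun [set: R] b2.
  by apply: measurable_fun_ltr; [exact: measurable_cst|exact: measurable_id].
have u1 : u (1 - a) < 1.
  move: a0; rewrite le_eqVlt => /predU1P[<-|a0]; first by rewrite subr0 tail1.
  by apply: tail_lt1 => //; rewrite ltr_norml; apply/andP; split; lra.
have u0 := tail_ge0 sigma0_unif (1 - a).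
have au : testfun1 (fun t => (1 - a < t)%R%:R) by solve_testfun1.
have id0 := law_id sigma0_unif n_gt0.
have b1m t : b1 (t + -1) = ~~ (1 - a < t).
  by rewrite /b1 -leNgt; apply/idP/idP; lra.
have b2m t : b2 (t + -1) = (1 - a < t).
  by rewrite /b2; apply/idP/idP; lra.
have m1m : law (fun t => (b1 (t + -1))%:R) = 1 - u (1 - a).
  rewrite -[X in X - _](law_cst sigma0_unif) -lawN// -lawD//; try by solve_testfun1.
  by apply: eq_law => t _; rewrite b1m; case: (_ < _); rewrite ?subrr ?subr0.
have m2m : law (fun t => (b2 (t + -1))%:R) = u (1 - a).
  by apply: eq_law => t _; rewrite b2m.
have m1p : law (fun t => (b1 (t + 1))%:R) = 0.
  apply/eqP; rewrite eq_le -{1}(law_pole sigma0_unif n_gt1); apply/andP; split.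
    apply: law_le; [exact: testfun1_shift|by solve_testfun1|] => t _.
    rewrite /b1; case: (leP (t + 1) (- a)) => ta; last by case: (t <= -1).
    by rewrite (_ : t <= -1)//; lra.
  by apply: law_ge0 => //; exact: testfun1_shift.
have m2p : law (fun t => (b2 (t + 1))%:R) = 1.
  have := lawD sigma0 (testfun1_shift mb1 1) (testfun1_shift mb2 1).
  rewrite m1p add0r => <-; rewrite -[RHS](law_cst sigma0_unif); apply: eq_law => t _.
  by rewrite /b1 /b2; case: leP => _ /=; rewrite ?addr0 ?add0r.
have N1 : law (fun t => (1 - t) * (b1 (t + -1))%:R) = 1 - u (1 - a) + K (1 - a).
  have -> : 1 - u (1 - a) + K (1 - a) =
     1 * law (fun=> 1) + -1 * law (fun t => t)
     + -1 * (1 * u (1 - a) + -1 * K (1 - a) + 0 * K (1 - a)).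
    by rewrite id0 law_cst//; ring.
  rewrite /tail /tmean -!law_lin3; try by solve_testfun1.
  by apply: eq_law => t _; rewrite b1m; case: (_ < _) => /=; ring.
have N2 : law (fun t => (1 - t) * (b2 (t + -1))%:R) = u (1 - a) - K (1 - a).
  have -> : u (1 - a) - K (1 - a) = 1 * u (1 - a) + -1 * K (1 - a) + 0 * K (1 - a).
    by ring.
  rewrite /tail /tmean -law_lin3; try by solve_testfun1.
  by apply: eq_law => t _; rewrite b2m; ring.
have P1 : law (fun t => (1 + t) * (b1 (t + 1))%:R) = 0.
  rewrite -[RHS](law_cst sigma0_unif); apply: eq_law => t.
  rewrite ler_norml => /andP[t1 _]; rewrite /b1; case: leP => ta; rewrite ?mulr0// mulr1; lra.
have P2 : law (fun t => (1 + t) * (b2 (t + 1))%:R) = 1.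
  transitivity (1 * law (fun=> 1) + 1 * law (fun t => t) + 0 * law (fun t => t));
    last by rewrite id0 law_cst//; ring.
  rewrite -law_lin3; try by solve_testfun1.
  apply: eq_law => t; rewrite ler_norml => /andP[t1 _].
  by rewrite /b2; case: ltP => ta /=; lra.
have M1 : slab_mass sigma0 b1 = (1 - u (1 - a)) / 2.
  by rewrite /slab_mass m1m m1p addr0.
have M2 : slab_mass sigma0 b2 = (1 + u (1 - a)) / 2.
  by rewrite /slab_mass m2m m2p addrC.
have swap (b : R -> bool) (mb : measurable_fun [set: R] b) :
    slab_moment sigma0 b = (law (fun t => (1 + t) * (b (t + 1))%:R)
      - law (fun t => (1 - t) * (b (t + -1))%:R)) / 2.
  have ab c : testfun1 (fun t => (b (t + c))%:R) by exact: testfun1_shift.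
  rewrite /slab_moment addrC -lawN; last by apply: testfun1M => //; solve_testfun1.
  by congr ((_ + _) / 2); apply: eq_law => t _; ring.
have Q1 := swap b1 mb1; have Q2 := swap b2 mb2.
rewrite P1 N1 in Q1; rewrite P2 N2 in Q2.
have S1 : slab_energy sigma0 b1 = 1 - u (1 - a) + K (1 - a).
  by rewrite /slab_energy N1 P1 addr0.
have S2 : slab_energy sigma0 b2 = u (1 - a) - K (1 - a) + 1.
  by rewrite /slab_energy N2 P2.
have C1 := cluster_cost_slab sigma0_unif n_gt1 mb1.
have C2 := cluster_cost_slab sigma0_unif n_gt1 mb2.
rewrite M1 S1 Q1 in C1; rewrite M2 S2 Q2 in C2.
rewrite /mse_cut /mse.
rewrite (_ : [set x : borelRV R n | _] = slab b1)//.
rewrite (_ : supp (n:=n) `\` slab b1 = slab b2); last first.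
  apply/seteqP; split => x; rewrite /slab /b1 /b2 /=.
    by move=> [Sx /not_andP[//|/negP]]; rewrite -ltNge.
  by move=> [Sx bx]; split => // -[_]; rewrite leNgt bx.
rewrite C1 ?C2 /=; [|lra..].
rewrite /gain; field.
by apply/andP; split; [|apply/andP; split]; rewrite gt_eqF//; nra.
Qed.

End error.

(* The dimension is n.+1. *)
Theorem theorem2p5 (R : realType) (n : nat) (n_gt3 : (3 < n.+1)%N)
    (sigma0 : probability (borelRV R n) R)
    (sigma0_unif : uniform_on_sphere sigma0) :
  (forall a : R, 0 < a < 2 ->
     derivable (mse_cut sigma0) a 1 /\ 0 < 'D_1 (mse_cut sigma0) a) /\
  (forall a : R, 0 <= a < 2 -> mse_cut sigma0 0 <= mse_cut sigma0 a) /\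
  (forall a : R, 0 <= a < 2 ->
     (forall b : R, 0 <= b < 2 -> mse_cut sigma0 a <= mse_cut sigma0 b) -> a = 0).
Proof.
have n_gt1 : (1 < n)%N by rewrite ltnS in n_gt3; exact: leq_trans n_gt3.
have E0 : mse_cut sigma0 0 = 1.
  rewrite mse_cutE//; last by rewrite lexx ltr0n.
  by rewrite subr0 gain1//; lra.
have Egt a : 0 < a < 2 -> 1 < mse_cut sigma0 a.
  move=> /andP[a0 a2]; rewrite mse_cutE//; last by rewrite ltW.
  have : gain sigma0 (1 - a) < 1.
    by apply: gain_lt1 => //; rewrite ltr_norml; apply/andP; split; lra.
  by lra.
split; [|split].
- move=> a /andP[a0 a2].
  have s1 : `|1 - a| < 1 by rewrite ltr_norml; apply/andP; split; lra.
  have [d d0 gd] := gain_derive_gt0 sigma0_unif n_gt1 s1.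
  have cut_derive : is_derive a 1 (mse_cut sigma0) d.
    have H : is_derive a 1 (fun b => 2 - gain sigma0 (1 - b)) d.
      have dl : is_derive a 1 (fun b : R => 1 - b) (-1).
        apply: (is_derive_eq (is_deriveB (is_derive_cst (1 : R) a 1) (is_derive_id a 1))).
        by rewrite sub0r.
      have dg := @is_derive1_comp R (gain sigma0) (fun b => 1 - b) a d (-1) gd dl.
      have := is_deriveB (is_derive_cst (2 : R) a 1) dg.
      by move=> H; apply: (is_derive_eq H); ring.
    apply: near_eq_is_derive H.
    near=> b; apply/esym/mse_cutE => //; apply/andP; split.
      by apply/ltW; near: b; exact: lt_nbhsr.
    by near: b; exact: lt_nbhsl.
  by split; [exact: ex_derive|rewrite (@derive_val _ _ _ _ _ _ _ cut_derive)].
- move=> a /andP[]; rewrite le_eqVlt => /predU1P[<-//|a0 a2].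
  by rewrite E0 ltW// Egt// a0.
- move=> a /andP[]; rewrite le_eqVlt => /predU1P[<-//|a0 a2] /(_ 0).
  have a02 : 0 < a < 2 by rewrite a0.
  by rewrite E0 lexx ltr0n leNgt Egt// => /(_ isT).
Unshelve. all: by end_near. Qed.
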